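(* Assume that all right-hand sides of assignments in an arbitrary program contain occurrences of at most one program variable. Then all inter-procedurally valid two-variable Herbrand equalities can be inferred, i.e., for every program point $u$ the set of all two-variable Herbrand equalities valid whenever $u$ is reached can be effectively determined.
   Context: $\Omega$ is a ranked signature with non-empty set of constants; values are ground terms over $\Omega$. A program consists of a finite set of parameterless procedures (including a main procedure) operating on a finite set $\mathbf{X}$ of global program variables; each procedure is a control flow graph with start and return points whose edges are labelled by assignments $\mathbf{x}=t$ with $t$ a term over $\Omega$ and $\mathbf{X}$, non-deterministic assignments $\mathbf{x}=?$ (assigning an arbitrary ground term), or procedure calls $q()$. States map program variables to ground terms; executions follow inter-procedurally valid paths (calls matched with returns) from the start point of main. An equality is valid at $u$ if it holds in every state with which $u$ can be reached. A two-variable Herbrand equality is an equality $s\doteq t$ between terms over $\Omega$ each containing occurrences of at most one program variable. *)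

(* Defs.v *)
From Stdlib Require List.
From mathcomp Require Import all_boot.

Set Implicit Arguments.
Unset Strict Implicit.
Unset Printing Implicit Defensive.

(* The numbering of the symbols carried by [countType] is what makes a symbol
   a possible datum for an algorithm.  [symb] may be infinite, and [arity] is
   not required to be computable. *)
Record signature := Signature { symb :> countType; arity : symb -> nat }.

Inductive term (Om : signature) (V : Type) : Type :=
| Var of V
| App (f : Om) of {ffun 'I_(arity f) -> term Om V}.

Arguments Var {Om V} _.
Arguments App {Om V} f _.

Definition ground (Om : signature) : Type := term Om void.

Fixpoint subst (Om : signature) (V W : Type) (s : V -> term Om W)
    (t : term Om V) : term Om W :=
  match t with
  | Var x => s x
  | App f a => App f [ffun i => subst s (a i)]
  end.

Fixpoint vars (Om : signature) (V : finType) (t : term Om V) : {set V} :=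
  match t with
  | Var x => [set x]
  | App f a => \bigcup_i vars (a i)
  end.

(* The variables are ['I_k] and the procedures are ['I_p]. *)

Inductive label (Om : signature) (k p : nat) : Type :=
| Assign of 'I_k & term Om 'I_k
| Havoc of 'I_k                        (* x = ? *)
| Call of 'I_p.

Arguments Assign {Om k p} _ _.
Arguments Havoc {Om k p} _.
Arguments Call {Om k p} _.

Record cfg (Om : signature) (k p : nat) : Type := Cfg {
  npoints : nat;
  start : 'I_npoints;
  return_ : 'I_npoints;
  edges : seq ('I_npoints * label Om k p * 'I_npoints)
}.

Record program (Om : signature) : Type := Program {
  nvars : nat;
  nprocs : nat;
  proc : 'I_nprocs -> cfg Om nvars nprocs;
  main : 'I_nprocs
}.

Definition point (Om : signature) (P : program Om) : Type :=
  {q : 'I_(nprocs P) & 'I_(npoints (proc q))}.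

Definition at_point (Om : signature) (P : program Om) (q : 'I_(nprocs P))
    (a : 'I_(npoints (proc q))) : point P :=
  existT (fun q => 'I_(npoints (proc q))) q a.

Definition unary_assignments (Om : signature) (P : program Om) : Prop :=
  forall (q : 'I_(nprocs P)) a x t b,
    List.In (a, Assign x t, b) (edges (proc q)) -> #|vars t| <= 1.

Definition state (Om : signature) (k : nat) : Type :=
  {ffun 'I_k -> ground Om}.

Definition update (Om : signature) (k : nat) (s : state Om k) (x : 'I_k)
    (v : ground Om) : state Om k :=
  [ffun y => if y == x then v else s y].

(* The components are the current point, the stack of the points to which the
   pending calls return, and the current state.  The stack is what matches
   returns with calls. *)
Definition config (Om : signature) (P : program Om) : Type :=
  (point P * seq (point P) * state Om (nvars P))%type.

Inductive step (Om : signature) (P : program Om) :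
    config P -> config P -> Prop :=
| step_assign q a x t b st s :
    List.In (a, Assign x t, b) (edges (proc q)) ->
    step (at_point a, st, s) (@at_point Om P q b, st, update s x (subst s t))
| step_havoc q a x b st s (v : ground Om) :
    List.In (a, Havoc x, b) (edges (proc q)) ->
    step (at_point a, st, s) (@at_point Om P q b, st, update s x v)
| step_call q a r b st s :
    List.In (a, Call r, b) (edges (proc q)) ->
    step (at_point a, st, s)
         (at_point (start (proc r)), @at_point Om P q b :: st, s)
| step_return q u st s :
    step (@at_point Om P q (return_ (proc q)), u :: st, s) (u, st, s).

(* The values of the variables at program start are arbitrary. *)
Inductive reaches (Om : signature) (P : program Om) : config P -> Prop :=
| reaches_init s : reaches (at_point (start (proc (main P))), [::], s)
| reaches_step c d : reaches c -> step c d -> reaches d.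

Definition equality (Om : signature) (k : nat) : Type :=
  (term Om 'I_k * term Om 'I_k)%type.

(* The two sides may mention different variables, the same one, or none. *)
Definition two_variable (Om : signature) (k : nat) (e : equality Om k) : bool :=
  (#|vars e.1| <= 1) && (#|vars e.2| <= 1).

Definition holds (Om : signature) (k : nat) (s : state Om k)
    (e : equality Om k) : Prop :=
  subst s e.1 = subst s e.2.

Definition valid_at (Om : signature) (P : program Om) (u : point P)
    (e : equality Om (nvars P)) : Prop :=
  forall st s, reaches (u, st, s) -> holds s e.

Definition entails (Om : signature) (k : nat) (E : seq (equality Om k))
    (e : equality Om k) : Prop :=
  forall s : state Om k, (forall e', List.In e' E -> holds s e') -> holds s e.

(* The model of computation is the first-order functional language over binary
   trees of N. D. Jones (Computability and Complexity from a Programming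
   Perspective): an algorithm is a finite list of mutually recursive unary
   functions on trees, the first of which is the entry point. *)

Inductive tree : Type := Leaf | Node of tree & tree.

Definition lchild (t : tree) : tree := if t is Node a _ then a else Leaf.
Definition rchild (t : tree) : tree := if t is Node _ b then b else Leaf.

Inductive expr : Type :=
| EArg                                 (* the argument of the current function *)
| ELeaf
| ENode of expr & expr
| ELeft of expr
| ERight of expr
| EIf of expr & expr & expr            (* [Leaf] is false *)
| ECall of nat & expr.

Definition algorithm : Type := seq expr.

(* [eval A x e v]: with the functions of [A] and argument [x], the evaluation
   of [e] terminates with value [v]. *)
Inductive eval (A : algorithm) (x : tree) : expr -> tree -> Prop :=
| eval_arg : eval A x EArg x
| eval_leaf : eval A x ELeaf Leaf
| eval_node e1 e2 v1 v2 :
    eval A x e1 v1 -> eval A x e2 v2 -> eval A x (ENode e1 e2) (Node v1 v2)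
| eval_left e v : eval A x e v -> eval A x (ELeft e) (lchild v)
| eval_right e v : eval A x e v -> eval A x (ERight e) (rchild v)
| eval_then e e1 e2 a b v :
    eval A x e (Node a b) -> eval A x e1 v -> eval A x (EIf e e1 e2) v
| eval_else e e1 e2 v :
    eval A x e Leaf -> eval A x e2 v -> eval A x (EIf e e1 e2) v
| eval_call f e y v :
    eval A x e y -> eval A y (nth ELeaf A f) v -> eval A x (ECall f e) v.

Definition runs (A : algorithm) (input output : tree) : Prop :=
  eval A input (ECall 0 EArg) output.

Definition code_bool (b : bool) : tree := if b then Node Leaf Leaf else Leaf.

Fixpoint code_nat (n : nat) : tree :=
  if n is m.+1 then Node Leaf (code_nat m) else Leaf.

Fixpoint code_seq (s : seq tree) : tree :=
  if s is t :: s' then Node t (code_seq s') else Leaf.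

Fixpoint code_term (Om : signature) (k : nat) (t : term Om 'I_k) : tree :=
  match t with
  | Var x => Node Leaf (code_nat x)
  | App f a =>
      Node (Node Leaf Leaf)
           (Node (code_nat (pickle f))
                 (code_seq [seq code_term (a i) | i <- enum 'I_(arity f)]))
  end.

Definition code_equality (Om : signature) (k : nat) (e : equality Om k) : tree :=
  Node (code_term e.1) (code_term e.2).

Definition code_label (Om : signature) (k p : nat) (l : label Om k p) : tree :=
  match l with
  | Assign x t => Node (code_nat 0) (Node (code_nat x) (code_term t))
  | Havoc x => Node (code_nat 1) (code_nat x)
  | Call q => Node (code_nat 2) (code_nat q)
  end.

Definition code_edge (Om : signature) (k p n : nat)
    (d : 'I_n * label Om k p * 'I_n) : tree :=
  let: (a, l, b) := d in
  Node (code_nat a) (Node (code_label l) (code_nat b)).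

Definition code_cfg (Om : signature) (k p : nat) (g : cfg Om k p) : tree :=
  Node (code_nat (npoints g))
    (Node (code_nat (start g))
      (Node (code_nat (return_ g))
        (code_seq [seq code_edge d | d <- edges g]))).

Definition code_program (Om : signature) (P : program Om) : tree :=
  Node (code_nat (nvars P))
    (Node (code_nat (nprocs P))
      (Node (code_seq [seq code_cfg (proc q) | q <- enum 'I_(nprocs P)])
            (code_nat (main P)))).

Definition code_point (Om : signature) (P : program Om) (u : point P) : tree :=
  Node (code_nat (projT1 u)) (code_nat (projT2 u)).

(* The set of valid two-variable equalities is infinite in general; it is
   computed in the form of a finite set [E] of which it is the set of
   two-variable consequences. *)
Definition infers (Om : signature) (A : algorithm) : Prop :=
  forall (P : program Om) (u : point P), unary_assignments P ->
  exists E : seq (equality Om (nvars P)),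
    [/\ runs A (Node (code_program P) (code_point u))
               (code_seq [seq code_equality e | e <- E]),
        all (@two_variable Om (nvars P)) E &
        forall e, two_variable e -> (valid_at u e <-> entails E e)].

Definition decides (Om : signature) (A : algorithm) : Prop :=
  forall (P : program Om) (u : point P), unary_assignments P ->
  forall e : equality Om (nvars P), two_variable e ->
  exists b : bool,
    runs A (Node (code_program P) (Node (code_point u) (code_equality e)))
           (code_bool b) /\ (b <-> valid_at u e).

(* Main.v *)
From HB Require Import structures.
From Stdlib Require Import Classical ClassicalEpsilon Eqdep_dec.
Require Import Defs.
From mathcomp Require Import all_boot all_order all_algebra zify.

Set Implicit Arguments.
Unset Strict Implicit.
Unset Printing Implicit Defensive.

(* Validity is decided by running the program up to a computable recursion
   depth.

   Two distinct ground terms [g1] and [g2] suffice as values of [x = ?] and of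
   the initial variables, since a context is determined by its values at two
   arguments.  What remains are compositions of unary substitutions, produced by
   a finite context-free grammar: its nonterminals are the same-level runs to a
   point, the runs that reach a point, and the edges and summarized calls
   between two points.

   For a bound [n] on the sizes of the terms involved, a ground value of size
   greater than [n ^ 2] factors in at most one way as an irreducible context of
   size at most [n] applied to a value (Levi's lemma).  Reading the contexts as
   digits turns large values into numbers on which contexts act by affine maps;
   together with the indicators of the finitely many small values, assignments
   thus become linear maps of a finite-dimensional space, and the validity of an
   equality becomes the vanishing of a linear form.  The span of the matrices of
   the runs derived within a given height is stationary as soon as it stops
   growing, hence from the dimension of the space on: runs of this height decide
   the validity of an equality on all runs.

   For the inference, let [s] be a reachable state.  A two-variable equality that
   holds in [s] reduces to equalities [x = t], where [t] arises from the value of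
   [x] in [s] by putting a variable [y] in place of some occurrences of the value
   of [y].  There are finitely many of them, and the valid ones generate all
   valid two-variable equalities. *)

(** * Computable functions on trees *)

Fixpoint tree_eqb (t u : tree) : bool :=
  match t, u with
  | Leaf, Leaf => true
  | Node a b, Node c d => tree_eqb a c && tree_eqb b d
  | _, _ => false
  end.

Lemma tree_eqbP : Equality.axiom tree_eqb.
Proof.
elim=> [|a IHa b IHb] [|c d] /=; try by constructor.
by apply: (iffP andP) => [[/IHa-> /IHb->]|[<- <-]] //; split; [apply/IHa|apply/IHb].
Qed.

HB.instance Definition _ := hasDecEq.Build tree tree_eqbP.

(* The code is given as a function of its position, so that pieces of code can
   be laid out one after the other without renumbering the calls. *)
Definition computable (f : tree -> tree) : Prop :=
  exists c : nat -> seq expr, forall (pre post : algorithm) x,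
    let B := pre ++ c (size pre) ++ post in
    eval B x (nth ELeaf B (size pre)) (f x).

Lemma computable_runs f :
  computable f -> exists A : algorithm, forall x, runs A x (f x).
Proof.
case=> c hc; exists (c 0) => x; apply: (eval_call (y := x)); first exact: eval_arg.
by have := hc [::] [::] x; rewrite /= cats0.
Qed.

(** The layout argument, made once: the entry [body] comes first, followed by the codes of [f1],
    [f2] and [f3]. [body] also receives its own position [n], which allows recursion; free slots are
    filled with [computable_id]. *)
Lemma computable_link (f1 f2 f3 f : tree -> tree)
    (body : nat -> nat -> nat -> nat -> expr) :
  computable f1 -> computable f2 -> computable f3 ->
  (forall (B : algorithm) n n1 n2 n3, nth ELeaf B n = body n n1 n2 n3 ->
     (forall x, eval B x (nth ELeaf B n1) (f1 x)) ->
     (forall x, eval B x (nth ELeaf B n2) (f2 x)) ->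
     (forall x, eval B x (nth ELeaf B n3) (f3 x)) ->
     forall x, eval B x (nth ELeaf B n) (f x)) ->
  computable f.
Proof.
case=> c1 h1 [c2 h2] [c3 h3] H.
pose n1 n := n.+1.
pose n2 n := n1 n + size (c1 (n1 n)).
pose n3 n := n2 n + size (c2 (n2 n)).
exists (fun n => body n (n1 n) (n2 n) (n3 n) ::
                 c1 (n1 n) ++ c2 (n2 n) ++ c3 (n3 n)) => pre post x.
set n := size pre; set e := body _ _ _ _; cbv zeta.
set B := pre ++ _.
have E1 : B = rcons pre e ++ c1 (n1 n) ++ (c2 (n2 n) ++ c3 (n3 n) ++ post).
  by rewrite /B cat_rcons /= !catA.
have E2 : B = (rcons pre e ++ c1 (n1 n)) ++ c2 (n2 n) ++ (c3 (n3 n) ++ post).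
  by rewrite E1 !catA.
have E3 : B = (rcons pre e ++ c1 (n1 n) ++ c2 (n2 n)) ++ c3 (n3 n) ++ post.
  by rewrite E1 !catA.
have s1 : size (rcons pre e) = n1 n by rewrite size_rcons.
have s2 : size (rcons pre e ++ c1 (n1 n)) = n2 n by rewrite size_cat s1.
have s3 : size (rcons pre e ++ c1 (n1 n) ++ c2 (n2 n)) = n3 n.
  by rewrite catA size_cat s2.
apply: (H B n (n1 n) (n2 n) (n3 n)) => [|y|y|y].
- by rewrite /B nth_cat ltnn subnn.
- by have := h1 (rcons pre e) (c2 (n2 n) ++ c3 (n3 n) ++ post) y; rewrite s1 -E1.
- by have := h2 (rcons pre e ++ c1 (n1 n)) (c3 (n3 n) ++ post) y; rewrite s2 -E2.
- have := h3 (rcons pre e ++ c1 (n1 n) ++ c2 (n2 n)) post y.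
  by rewrite s3 -E3.
Qed.

Lemma computable_id : computable id.
Proof.
exists (fun _ => [:: EArg]) => pre post x /=.
by rewrite nth_cat ltnn subnn /=; exact: eval_arg.
Qed.

Lemma computable_expr f (e : expr) :
  (forall B x, eval B x e (f x)) -> computable f.
Proof.
move=> h; apply: (computable_link (body := fun _ _ _ _ => e)
  computable_id computable_id computable_id) => B n _ _ _ -> _ _ _ x.
exact: h.
Qed.

Lemma computable_const t : computable (fun=> t).
Proof.
have [e he] : exists e, forall B x, eval B x e t.
  elim: t => [|a [ea ha] b [eb hb]]; first by exists ELeaf => *; exact: eval_leaf.
  by exists (ENode ea eb) => *; exact: eval_node.
exact: (computable_expr he).
Qed.

Lemma computable_comp f g :
  computable f -> computable g -> computable (fun x => f (g x)).
Proof.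
move=> hf hg; apply: (computable_link
  (body := fun _ n1 n2 _ => ECall n1 (ECall n2 EArg)) hf hg computable_id).
move=> B n n1 n2 n3 -> h1 h2 _ x.
apply: eval_call (h1 _); apply: eval_call (h2 _); exact: eval_arg.
Qed.

Lemma computable_lchild f : computable f -> computable (fun x => lchild (f x)).
Proof.
apply: computable_comp; apply: (@computable_expr _ (ELeft EArg)) => B x.
by apply: eval_left; exact: eval_arg.
Qed.

Lemma computable_rchild f : computable f -> computable (fun x => rchild (f x)).
Proof.
apply: computable_comp; apply: (@computable_expr _ (ERight EArg)) => B x.
by apply: eval_right; exact: eval_arg.
Qed.

Lemma computable_node f g :
  computable f -> computable g -> computable (fun x => Node (f x) (g x)).
Proof.
move=> hf hg; apply: (computable_link
  (body := fun _ n1 n2 _ => ENode (ECall n1 EArg) (ECall n2 EArg))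
  hf hg computable_id) => B n n1 n2 n3 -> h1 h2 _ x.
by apply: eval_node; [apply: eval_call (h1 _)|apply: eval_call (h2 _)];
  exact: eval_arg.
Qed.

Definition tif (c a b : tree) : tree := if c is Node _ _ then a else b.

Lemma computable_tif c f g : computable c -> computable f -> computable g ->
  computable (fun x => tif (c x) (f x) (g x)).
Proof.
move=> hc hf hg; apply: (computable_link
  (body := fun _ n1 n2 n3 => EIf (ECall n1 EArg) (ECall n2 EArg) (ECall n3 EArg))
  hc hf hg) => B n n1 n2 n3 -> h1 h2 h3 x.
have h0 : eval B x (ECall n1 EArg) (c x).
  by apply: eval_call (h1 _); exact: eval_arg.
case E: (c x) h0 => [|a b] h0 /=.
- by apply: eval_else h0 _; apply: eval_call (h3 _); exact: eval_arg.
- by apply: eval_then h0 _; apply: eval_call (h2 _); exact: eval_arg.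
Qed.

(** Structural recursion on trees. Lists and numbers are right spines, so recursion on them is the
    case in which the result for the left child is ignored. *)
Fixpoint trec (z : tree) (s : tree -> tree -> tree -> tree -> tree) (t : tree) :
    tree :=
  if t is Node a b then s a b (trec z s a) (trec z s b) else z.

(** Functions of the language are unary: the parameter travels in the left child of the argument and
    the current subtree in the right one. The second hypothesis unpacks the parameter, the two
    children and the two recursive results from a single tree. *)
Lemma computable_trec z s t :
  computable z ->
  computable (fun y => s (lchild y) (lchild (lchild (rchild y)))
    (rchild (lchild (rchild y))) (lchild (rchild (rchild y)))
    (rchild (rchild (rchild y)))) ->
  computable t ->
  computable (fun x => trec (z x) (s x) (t x)).
Proof.
set s' := (fun y => s _ _ _ _ _) => hz hs ht.
pose r y := trec (z (lchild y)) (s (lchild y)) (rchild y).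
suff hr : computable r.
  exact: (computable_comp hr (computable_node computable_id ht)).
pose sub e := ENode (ELeft EArg) e.
apply: (computable_link (body := fun n n1 n2 _ =>
  EIf (ERight EArg)
   (ECall n2 (ENode (ELeft EArg) (ENode (ERight EArg)
     (ENode (ECall n (sub (ELeft (ERight EArg))))
            (ECall n (sub (ERight (ERight EArg))))))))
   (ECall n1 (ELeft EArg))) hz hs computable_id) => B n n1 n2 n3 Bn h1 h2 _ y.
have arg q : eval B q EArg q by exact: eval_arg.
(* The code inspects its argument only through the two projections, and [y] may be [Leaf]; hence a
   claim about every [q] that projects to [p] and [u]. *)
suff h p u q : eval B q (ELeft EArg) p -> eval B q (ERight EArg) u ->
    eval B q (nth ELeaf B n) (r (Node p u)).
  by apply: (h (lchild y) (rchild y)); [apply: eval_left|apply: eval_right].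
elim: u q => [|a IHa b IHb] q hp hu; rewrite Bn.
  apply: eval_else hu _; exact: eval_call hp (h1 p).
apply: eval_then (hu) _.
have self c : (forall q, eval B q (ELeft EArg) p -> eval B q (ERight EArg) c ->
      eval B q (nth ELeaf B n) (r (Node p c))) ->
    eval B (Node p c) (nth ELeaf B n) (r (Node p c)).
  apply; first exact: eval_left (arg (Node p c)).
  exact: eval_right (arg (Node p c)).
apply: (eval_call (y := Node p (Node (Node a b) (Node (r (Node p a)) (r (Node p b)))))).
  apply: eval_node => //; apply: eval_node => //; apply: eval_node.
  - apply: eval_call (self a IHa).
    by apply: eval_node => //; exact: (eval_left hu).
  - apply: eval_call (self b IHb).
    by apply: eval_node => //; exact: (eval_right hu).
exact: h2.
Qed.

(** Comparison descends in two trees at once, which [trec] does not do directly; hence a recursive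
    code of its own. *)
Lemma computable_eq f g : computable f -> computable g ->
  computable (fun x => code_bool (f x == g x)).
Proof.
move=> hf hg.
pose q y := code_bool (lchild y == rchild y).
suff hq : computable q by exact: (computable_comp hq (computable_node hf hg)).
pose tt := ENode ELeaf ELeaf.
pose l := ELeft EArg; pose r := ERight EArg.
apply: (computable_link (body := fun n _ _ _ =>
  EIf l (EIf r (EIf (ECall n (ENode (ELeft l) (ELeft r)))
                    (ECall n (ENode (ERight l) (ERight r))) ELeaf) ELeaf)
        (EIf r ELeaf tt)) computable_id computable_id computable_id).
move=> B n _ _ _ Bn _ _ _ y; rewrite Bn.
have [hl hr] : eval B y l (lchild y) /\ eval B y r (rchild y).
  by split; [apply: eval_left|apply: eval_right]; exact: eval_arg.
rewrite /q; move: (lchild y) (rchild y) hl hr => u v.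
elim: u v y => [|a IHa b IHb] [|c d] y hl hr.
- apply: eval_else hl _; apply: eval_else hr _.
  by apply: eval_node; exact: eval_leaf.
- apply: eval_else hl _; apply: eval_then hr _; exact: eval_leaf.
- apply: eval_then hl _; apply: eval_else hr _; exact: eval_leaf.
have -> : (Node a b == Node c d) = (a == c) && (b == d) by [].
apply: eval_then (hl) _; apply: eval_then (hr) _.
have arg z : eval B z EArg z by exact: eval_arg.
have eac : eval B y (ECall n (ENode (ELeft l) (ELeft r))) (code_bool (a == c)).
  apply: (eval_call (y := Node a c)).
    by apply: eval_node; [exact: (eval_left hl)|exact: (eval_left hr)].
  rewrite Bn; apply: IHa; first exact: (eval_left (arg (Node a c))).
  exact: (eval_right (arg (Node a c))).
case: (a == c) eac => /= eac; last by apply: eval_else eac _; exact: eval_leaf.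
apply: eval_then eac _; apply: (eval_call (y := Node b d)).
  by apply: eval_node; [exact: (eval_right hl)|exact: (eval_right hr)].
rewrite Bn; apply: IHb; first exact: (eval_left (arg (Node b d))).
exact: (eval_right (arg (Node b d))).
Qed.

(** * Lists, numbers and booleans as trees *)

Fixpoint tlist (t : tree) : seq tree :=
  if t is Node a b then a :: tlist b else [::].

(** Every tree codes exactly one list, the left children along its right spine, so decoding never
    fails. *)
Lemma tlistK : cancel tlist code_seq.
Proof. by elim=> //= a _ b ->. Qed.

Lemma code_seqK : cancel code_seq tlist.
Proof. by elim=> //= a s ->. Qed.

Lemma code_natK (n : nat) : code_seq (nseq n Leaf) = code_nat n.
Proof. by elim: n => //= n ->. Qed.

Notation lcomputable L := (computable (fun x => code_seq (L x))).
Notation ncomputable N := (computable (fun x => code_nat (N x))).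
Notation bcomputable b := (computable (fun x => code_bool (b x))).

Lemma lcomputable_tlist f : computable f -> lcomputable (fun x => tlist (f x)).
Proof.
by case=> c h; exists c => pre post x; rewrite tlistK; exact: h.
Qed.

Lemma eq_computable f g : f =1 g -> computable f -> computable g.
Proof. by move=> e [c h]; exists c => pre post x; rewrite -e; exact: h. Qed.

Lemma lcomputable_cons f L :
  computable f -> lcomputable L -> lcomputable (fun x => f x :: L x).
Proof. exact: computable_node. Qed.

Lemma lcomputable_cat L M :
  lcomputable L -> lcomputable M -> lcomputable (fun x => L x ++ M x).
Proof.
move=> hL hM.
apply: (@eq_computable (fun x =>
  trec (code_seq (M x)) (fun a _ _ r => Node a r) (code_seq (L x)))).
  by move=> x; elim: (L x) => //= a s ->.
apply: computable_trec => //.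
do 2?[apply: computable_node];
  by repeat first [exact: computable_id | apply: computable_rchild | apply: computable_lchild].
Qed.

Lemma lcomputable_map F L : lcomputable L ->
  computable (fun y => F (lchild y) (rchild y)) ->
  lcomputable (fun x => [seq F x a | a <- L x]).
Proof.
move=> hL hF.
apply: (@eq_computable (fun x =>
  trec Leaf (fun a _ _ r => Node (F x a) r) (code_seq (L x)))).
  by move=> x; elim: (L x) => //= a s ->.
apply: computable_trec => //; first exact: computable_const.
apply: computable_node;
  last by repeat first [exact: computable_id | apply: computable_rchild].
apply: (@computable_comp (fun y => F (lchild y) (rchild y))
  (fun y => Node (lchild y) (lchild (lchild (rchild y))))) => //.
by apply: computable_node;
  repeat first [exact: computable_id | apply: computable_rchild | apply: computable_lchild].
Qed.

Lemma lcomputable_flatmap F L : lcomputable L ->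
  lcomputable (fun y => F (lchild y) (rchild y)) ->
  lcomputable (fun x => flatten [seq F x a | a <- L x]).
Proof.
move=> hL hF.
apply: (@eq_computable (fun x => trec Leaf
  (fun a _ _ r => code_seq (F x a ++ tlist r)) (code_seq (L x)))).
  by move=> x; elim: (L x) => //= a s ->; rewrite code_seqK.
apply: computable_trec => //; first exact: computable_const.
apply: lcomputable_cat; last first.
  apply: lcomputable_tlist.
  by repeat first [exact: computable_id | apply: computable_rchild].
apply: (@computable_comp (fun y => code_seq (F (lchild y) (rchild y)))
  (fun y => Node (lchild y) (lchild (lchild (rchild y))))) => //.
by apply: computable_node;
  repeat first [exact: computable_id | apply: computable_rchild | apply: computable_lchild].
Qed.

Lemma computable_if b f g : bcomputable b -> computable f -> computable g ->
  computable (fun x => if b x then f x else g x).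
Proof.
move=> hb hf hg; apply: eq_computable (computable_tif hb hf hg) => x.
by case: (b x).
Qed.

Lemma lcomputable_if b L M : bcomputable b -> lcomputable L -> lcomputable M ->
  lcomputable (fun x => if b x then L x else M x).
Proof.
move=> hb hL hM; apply: eq_computable (computable_if hb hL hM) => x.
by case: (b x).
Qed.

Lemma bcomputable_and b c :
  bcomputable b -> bcomputable c -> bcomputable (fun x => b x && c x).
Proof.
move=> hb hc.
apply: eq_computable (computable_if hb hc (computable_const Leaf)) => x.
by case: (b x).
Qed.

Lemma lcomputable_filter p L : lcomputable L ->
  bcomputable (fun y => p (lchild y) (rchild y)) ->
  lcomputable (fun x => [seq a <- L x | p x a]).
Proof.
move=> hL hp.
apply: (@eq_computable (fun x => code_seq
  (flatten [seq (if p x a then [:: a] else [::]) | a <- L x]))).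
  move=> x; congr code_seq; elim: (L x) => //= a s ->; by case: (p x a).
apply: lcomputable_flatmap => //; apply: lcomputable_if => //.
- apply: lcomputable_cons; last exact: computable_const.
  exact: computable_rchild computable_id.
- exact: computable_const.
Qed.

Lemma bcomputable_all p L : lcomputable L ->
  bcomputable (fun y => p (lchild y) (rchild y)) ->
  bcomputable (fun x => all (p x) (L x)).
Proof.
move=> hL hp.
apply: (@eq_computable (fun x => trec (code_bool true)
  (fun a _ _ r => if p x a then r else Leaf) (code_seq (L x)))).
  by move=> x; elim: (L x) => //= a s ->; case: (p x a).
apply: computable_trec => //; first exact: computable_const.
apply: computable_if; last exact: computable_const.
- apply: (@computable_comp (fun y => code_bool (p (lchild y) (rchild y)))
    (fun y => Node (lchild y) (lchild (lchild (rchild y))))) => //.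
  by apply: computable_node;
  repeat first [exact: computable_id | apply: computable_rchild | apply: computable_lchild].
- by repeat first [exact: computable_id | apply: computable_rchild].
Qed.

Lemma computable_iter N F f : ncomputable N ->
  computable (fun y => F (lchild y) (rchild y)) -> computable f ->
  computable (fun x => iter (N x) (F x) (f x)).
Proof.
move=> hN hF hf.
apply: (@eq_computable (fun x =>
  trec (f x) (fun _ _ _ r => F x r) (code_nat (N x)))).
  by move=> x; elim: (N x) => //= n ->.
apply: computable_trec => //.
apply: (@computable_comp (fun y => F (lchild y) (rchild y))
  (fun y => Node (lchild y) (rchild (rchild (rchild y))))) => //.
by apply: computable_node;
  repeat first [exact: computable_id | apply: computable_rchild | apply: computable_lchild].
Qed.

Lemma ncomputable_add M N :
  ncomputable M -> ncomputable N -> ncomputable (fun x => M x + N x).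
Proof.
move=> hM hN.
apply: (@eq_computable (fun x => iter (M x) (Node Leaf) (code_nat (N x)))).
  by move=> x; elim: (M x) => //= n ->.
apply: (computable_iter (F := fun _ => Node Leaf)) => //.
by apply: computable_node; [exact: computable_const|exact: computable_rchild computable_id].
Qed.

(** Multiplication iterates addition on codes; [size (tlist t)] reads a number back from its
    code. *)
Lemma ncomputable_mul M N :
  ncomputable M -> ncomputable N -> ncomputable (fun x => M x * N x).
Proof.
move=> hM hN.
apply: (@eq_computable (fun x => iter (M x)
  (fun t => code_nat (N x + size (tlist t))) Leaf)).
  move=> x; elim: (M x) => //= n ->.
  by rewrite -(code_natK (n * _)) code_seqK size_nseq mulSn.
apply: (computable_iter (F := fun x t => code_nat (N x + size (tlist t)))) => //;
  last exact: computable_const.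
apply: (@eq_computable (fun y =>
  iter (N (lchild y)) (Node Leaf) (code_nat (size (tlist (rchild y)))))).
  by move=> y; elim: (N _) => //= n ->.
apply: (computable_iter (F := fun _ => Node Leaf)).
- exact: (computable_comp hN (computable_lchild computable_id)).
- by apply: computable_node; [exact: computable_const|exact: computable_rchild computable_id].
apply: (@eq_computable (fun y => trec Leaf (fun _ _ _ r => Node Leaf r) (rchild y))).
  by move=> y; elim: (rchild y) => //= a _ b ->.
apply: computable_trec; first exact: computable_const.
- apply: computable_node; first exact: computable_const.
  by repeat first [exact: computable_id | apply: computable_rchild].
exact: computable_rchild computable_id.
Qed.

Lemma ncomputable_exp M N :
  ncomputable M -> ncomputable N -> ncomputable (fun x => M x ^ N x).
Proof.
move=> hM hN.
apply: (@eq_computable (fun x => iter (N x)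
  (fun t => code_nat (M x * size (tlist t))) (code_nat 1))).
  move=> x; elim: (N x) => //= n ->.
  by rewrite -(code_natK (_ ^ n)) code_seqK size_nseq expnS.
apply: (computable_iter (F := fun x t => code_nat (M x * size (tlist t)))) => //;
  last exact: computable_const.
apply: ncomputable_mul; first exact: (computable_comp hM (computable_lchild computable_id)).
apply: (@eq_computable (fun y => trec Leaf (fun _ _ _ r => Node Leaf r) (rchild y))).
  by move=> y; elim: (rchild y) => //= a _ b ->.
apply: computable_trec; first exact: computable_const.
- apply: computable_node; first exact: computable_const.
  by repeat first [exact: computable_id | apply: computable_rchild].
exact: computable_rchild computable_id.
Qed.

Fixpoint tree_size (t : tree) : nat :=
  if t is Node a b then (tree_size a + tree_size b).+1 else 0.

Lemma ncomputable_tree_size f :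
  computable f -> ncomputable (fun x => tree_size (f x)).
Proof.
move=> hf; apply: (@eq_computable (fun x => trec Leaf
  (fun _ _ l r => Node Leaf (code_seq (tlist l ++ tlist r))) (f x))).
  move=> x; elim: (f x) => //= a -> b ->.
  rewrite -!code_natK !code_seqK -nseqD; by case: (nseq _ _).
apply: computable_trec => //; first exact: computable_const.
apply: computable_node; first exact: computable_const.
apply: lcomputable_cat; apply: lcomputable_tlist;
  by repeat first [exact: computable_id | apply: computable_rchild | apply: computable_lchild].
Qed.

(** * Terms and contexts *)

Section Terms.
Variable Om : signature.

(** The arguments of [App] are nested in a finite function, so the principle is proved by a direct
    fixpoint. *)
Lemma term_nested_ind (V : Type) (P : term Om V -> Prop) :
  (forall x, P (Var x)) ->
  (forall f (a : {ffun 'I_(arity f) -> term Om V}), (forall i, P (a i)) ->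
     P (App f a)) ->
  forall t, P t.
Proof.
move=> hV hA; fix IH 1 => -[x|f a]; first exact: hV.
by apply: hA => i; exact: IH.
Defined.

Lemma App_inj (V : Type) f (a b : {ffun 'I_(arity f) -> term Om V}) :
  App f a = App f b -> a = b.
Proof.
case=> E; apply: (inj_pair2_eq_dec _ _ _ _ _ _ E).
exact: (fun x y => decP (x =P y)).
Qed.

(** Generalizes [code_term] to any numbering of the variables, for use on ground terms and for a
    boolean equality of terms. *)
Fixpoint code_with (V : Type) (c : V -> nat) (t : term Om V) : tree :=
  match t with
  | Var x => Node Leaf (code_nat (c x))
  | App f a =>
      Node (Node Leaf Leaf)
           (Node (code_nat (pickle f))
                 (code_seq [seq code_with c (a i) | i <- enum 'I_(arity f)]))
  end.

Lemma code_seq_inj : injective code_seq.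
Proof. exact: can_inj code_seqK. Qed.

Lemma code_nat_inj : injective code_nat.
Proof. by elim=> [|m IH] [|n] //= [/IH ->]. Qed.

Lemma code_with_inj (V : Type) (c : V -> nat) :
  injective c -> injective (code_with c).
Proof.
move=> cI; elim/term_nested_ind=> [x|f a IH] [y|g b] //=.
  by case=> /code_nat_inj/cI ->.
case=> /code_nat_inj/(pcan_inj pickleK) E; case: g / E b => b.
move/code_seq_inj/eq_in_map => E; congr App; apply/ffunP => i.
by apply: IH; apply: E; rewrite mem_enum.
Qed.

Lemma code_termE k (t : term Om 'I_k) : code_term t = code_with (@nat_of_ord k) t.
Proof.
elim/term_nested_ind: t => //= f a IH.
by congr (Node _ (Node _ (code_seq _))); apply: eq_map => i; exact: IH.
Qed.

Lemma code_term_inj k : injective (@code_term Om k).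
Proof. by move=> t u; rewrite !code_termE; apply/code_with_inj/ord_inj. Qed.

End Terms.

Definition term_eqb (Om : signature) (V : countType) (t u : term Om V) : bool :=
  code_with pickle t == code_with pickle u.

Lemma term_eqbP (Om : signature) (V : countType) :
  Equality.axiom (@term_eqb Om V).
Proof.
move=> t u; apply: (iffP eqP) => [|-> //].
exact/code_with_inj/(pcan_inj pickleK).
Qed.

HB.instance Definition _ (Om : signature) (V : countType) :=
  hasDecEq.Build (term Om V) (@term_eqbP Om V).

Section Substitution.
Variable Om : signature.
Implicit Types V W : Type.

Lemma subst_comp V W U (s : V -> term Om W) (r : W -> term Om U) t :
  subst r (subst s t) = subst (fun x => subst r (s x)) t.
Proof.
elim/term_nested_ind: t => //= f a IH; congr App; apply/ffunP => i.
by rewrite !ffunE.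
Qed.

Lemma eq_subst V W (s r : V -> term Om W) : s =1 r -> subst s =1 subst r.
Proof.
move=> e; elim/term_nested_ind=> //= f a IH; congr App; apply/ffunP => i.
by rewrite !ffunE.
Qed.

Lemma subst_id V (t : term Om V) : subst (fun x => Var x) t = t.
Proof.
elim/term_nested_ind: t => //= f a IH; congr App; apply/ffunP => i.
by rewrite ffunE.
Qed.

Lemma eq_subst_vars (V : finType) W (s r : V -> term Om W) (t : term Om V) :
  (forall x, x \in vars t -> s x = r x) -> subst s t = subst r t.
Proof.
elim/term_nested_ind: t => [x|f a IH] /= e; first by apply: e; rewrite inE.
congr App; apply/ffunP => i; rewrite !ffunE; apply: IH => x xi.
by apply: e; apply/bigcupP; exists i.
Qed.

Definition void_elim (T : Type) (v : void) : T := match v with end.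

Definition of_ground V (g : ground Om) : term Om V := subst (@void_elim _) g.

Lemma subst_of_ground V W (s : V -> term Om W) g : subst s (of_ground V g) = of_ground W g.
Proof. by rewrite /of_ground subst_comp; apply: eq_subst => -[]. Qed.

Lemma subst_of_ground_ground V (s : V -> ground Om) g : subst s (of_ground V g) = g.
Proof.
by rewrite /of_ground subst_comp -[RHS]subst_id; apply: eq_subst => -[].
Qed.

Lemma of_ground_void g : of_ground void g = g.
Proof. by rewrite /of_ground -[RHS]subst_id; apply: eq_subst => -[]. Qed.

Lemma vars_of_ground (V : finType) g : vars (of_ground V g) = set0.
Proof.
elim/term_nested_ind: g => [x|f a IH] /=; first by case: x.
by apply: big1 => i _; rewrite ffunE; exact: IH.
Qed.

(* Terms over [unit] play the role of the contexts; the hole may occur any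
   number of times, or not at all. *)
Definition plug V (p : term Om unit) (t : term Om V) : term Om V :=
  subst (fun=> t) p.

Lemma plugA V p q (t : term Om V) : plug p (plug q t) = plug (plug p q) t.
Proof. by rewrite /plug subst_comp. Qed.

Lemma plug_Var V (t : term Om V) : plug (Var tt) t = t.
Proof. by []. Qed.

Lemma plug_id p : plug p (Var tt) = p.
Proof. by rewrite /plug -[RHS]subst_id; apply: eq_subst => -[]. Qed.

Lemma subst_plug V W (s : V -> term Om W) p t :
  subst s (plug p t) = plug p (subst s t).
Proof. by rewrite /plug subst_comp. Qed.

(** * Sizes, cancellation and Levi's lemma for contexts *)

Fixpoint term_size V (t : term Om V) : nat :=
  match t with
  | Var _ => 1
  | App f a => (\sum_i term_size (a i)).+1
  end.

Lemma term_size_gt0 V (t : term Om V) : 0 < term_size t.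
Proof. by case: t. Qed.

Fixpoint has_hole V (t : term Om V) : bool :=
  match t with
  | Var _ => true
  | App f a => [exists i, has_hole (a i)]
  end.

Lemma term_size_arg V f (a : {ffun 'I_(arity f) -> term Om V}) i :
  term_size (a i) < term_size (App f a).
Proof. by rewrite /= ltnS (bigD1 i) //= leq_addr. Qed.

Lemma has_hole_of_ground V (g : ground Om) : ~~ has_hole (of_ground V g).
Proof.
elim/term_nested_ind: g => [[]|f a IH]; apply/existsPn => i.
by rewrite ffunE; exact: IH.
Qed.

Lemma no_hole_plug V p (t u : term Om V) : ~~ has_hole p -> plug p t = plug p u.
Proof.
rewrite /plug; elim/term_nested_ind: p => //= f a IH /existsPn h.
by congr App; apply/ffunP => i; rewrite !ffunE; apply: IH; exact: h.
Qed.

Lemma no_hole_of_ground p : ~~ has_hole p -> exists g, p = of_ground unit g.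
Proof.
elim/term_nested_ind: p => //= f a IH /existsPn h.
suff [b hb] : exists b : {ffun 'I_(arity f) -> ground Om},
    forall i, a i = of_ground unit (b i).
  exists (App f b); rewrite /of_ground /=; congr App; apply/ffunP => i.
  by rewrite ffunE hb.
have : forall i, exists b, a i = of_ground unit b by move=> i; exact: IH.
case/fin_all_exists => b hb; exists (finfun b) => i; by rewrite ffunE.
Qed.

Lemma term_size_of_ground V (g : ground Om) : term_size (of_ground V g) = term_size g.
Proof.
elim/term_nested_ind: g => [[]|f a IH] /=; congr S.
by apply: eq_bigr => i _; rewrite ffunE IH.
Qed.

(** One hole, of size 1, gives way to [t]; no other subterm shrinks. *)
Lemma term_size_plug_ge V p (t : term Om V) : has_hole p ->
  term_size p + term_size t <= (term_size (plug p t)).+1.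
Proof.
rewrite /plug; elim/term_nested_ind: p => [x|f a IH] /=; first by rewrite add1n.
case/existsP => i hi; rewrite addSn !ltnS (bigD1 i) //= [in leqRHS](bigD1 i) //=.
rewrite addnAC -addSn leq_add //; first by rewrite ffunE; exact: IH.
apply: leq_sum => j _; rewrite ffunE.
case hj: (has_hole (a j)).
  rewrite -ltnS; apply: leq_trans (IH j hj).
  by rewrite -addn1 leq_add2l term_size_gt0.
elim/term_nested_ind: (a j) hj => //= g b IHb /negbT/existsPn hb.
by rewrite ltnS leq_sum // => l _; rewrite ffunE IHb //; apply/negbTE/hb.
Qed.

Lemma term_size_plug_le V p (t : term Om V) :
  term_size (plug p t) <= term_size p * term_size t.
Proof.
rewrite /plug; elim/term_nested_ind: p => [x|f a IH] /=; first by rewrite mul1n.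
rewrite mulSn -add1n leq_add ?term_size_gt0 // big_distrl /=.
by apply: leq_sum => i _; rewrite ffunE.
Qed.

Lemma term_size_plug_hole V p (t : term Om V) :
  has_hole p -> p <> Var tt -> term_size t < term_size (plug p t).
Proof.
move=> hp np; rewrite -ltnS; apply: leq_trans (term_size_plug_ge t hp).
rewrite -add2n leq_add2r.
case: p hp np => [[]|f a] //= /existsP [i _] _.
by rewrite ltnS (bigD1 i) //= addn_gt0 term_size_gt0.
Qed.

Lemma plug_inj V p : has_hole p -> injective (@plug V p).
Proof.
rewrite /plug; elim/term_nested_ind: p => [x|f a IH] h; first by move=> t u.
move: h => /existsP [i hi] t u /App_inj/ffunP/(_ i).
by rewrite !ffunE; exact: IH.
Qed.

(** Descend in both contexts in parallel until one of them is the hole; the other then fixes both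
    [t] and [u]. A proper context with a hole enlarges its argument and one without a hole is
    constant, so only the hole fixes two distinct terms. *)
Lemma plug_two_points V p q (t u : term Om V) : t <> u ->
  plug p t = plug q t -> plug p u = plug q u -> p = q.
Proof.
move=> tu.
have var r : plug r t = t -> plug r u = u -> r = Var tt.
  move=> rt ru; case: (boolP (has_hole r)) => hr.
    apply: NNPP => nr; have := term_size_plug_hole t hr nr.
    by rewrite rt ltnn.
  by case: tu; rewrite -rt -ru; exact: no_hole_plug.
rewrite /plug in var *.
elim/term_nested_ind: p q => [[]|f a IH] q; first by move=> /esym h1 /esym h2; rewrite (var q).
case: q => [[]|g b]; first by move=> h1 h2; rewrite -(var (App f a)).
move=> /= e1 e2; have [E _] := e1; case: g / E b e1 e2 => b.
move=> /App_inj/ffunP e1 /App_inj/ffunP e2; congr App; apply/ffunP => i.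
by have := e1 i; have := e2 i; rewrite !ffunE => ? ?; exact: IH.
Qed.

(** The descent of [plug_two_points] with one argument: a context smaller than [t] cannot be the
    constant [t], so it fixes [t] only if it is the hole. *)
Lemma plug_eq_small V p q (t : term Om V) :
  term_size p < term_size t -> term_size q < term_size t ->
  plug p t = plug q t -> p = q.
Proof.
have var r : term_size r < term_size t -> plug r t = t -> r = Var tt.
  move=> sr rt; case: (boolP (has_hole r)) => hr.
    apply: NNPP => nr; have := term_size_plug_hole t hr nr.
    by rewrite rt ltnn.
  have [g gr] := no_hole_of_ground hr; move: sr; rewrite -rt gr /plug subst_of_ground.
  by rewrite !term_size_of_ground ltnn.
rewrite /plug in var *.
elim/term_nested_ind: p q => [[]|f a IH] q sp sq.
  by move=> /esym h1; rewrite (var q).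
case: q sq => [[]|g b] sq; first by move=> h1; rewrite -(var (App f a)).
move=> /= e1; have [E _] := e1; case: g / E b e1 sq => b.
move=> /App_inj/ffunP e1 sq; congr App; apply/ffunP => i.
apply: IH; last by have := e1 i; rewrite !ffunE.
- exact: ltn_trans (term_size_arg a i) sp.
- exact: ltn_trans (term_size_arg b i) sq.
Qed.

(** Two factorizations of one term are comparable, as in Levi's lemma for words. The descent in [p]
    ends at a hole, where what is left of [q] is the remainder [r]. By [plug_eq_small], different
    holes of [p] yield the same remainder, and arguments of [p] without a hole agree with those of
    [q]. *)
Lemma plug_levi p q (a b : ground Om) :
  term_size p < term_size b -> term_size q < term_size b ->
  term_size b <= term_size a -> has_hole p -> plug p a = plug q b ->
  exists2 r, q = plug p r & plug r b = a.
Proof.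
move=> sp sq ba.
elim/term_nested_ind: p q sp sq => [[]|f u IH] q sp sq hp e.
  by exists q.
case: q sq e => [[]|g v] sq e.
  (* Here [q] is the hole and [p] is not, so [b] would be larger than [a]. *)
  have := @term_size_plug_hole _ (App f u) a hp (fun h => ltac:(discriminate h)).
  by rewrite e plug_Var ltnNge ba.
have [E _] := e; case: g / E v sq e => v sq /App_inj/ffunP e.
have ei i : plug (u i) a = plug (v i) b by have := e i; rewrite !ffunE.
have su i := ltn_trans (term_size_arg u i) sp.
have sv i := ltn_trans (term_size_arg v i) sq.
have {hp} /existsP [i0 h0] := hp.
have [r r0 rb] := IH i0 _ (su i0) (sv i0) h0 (ei i0).
exists r => //; congr App; apply/ffunP => i; rewrite ffunE.
case: (boolP (has_hole (u i))) => hi.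
  have [r' r1 rb'] := IH i _ (su i) (sv i) hi (ei i).
  have sr s j : v j = plug (u j) s -> has_hole (u j) -> term_size s < term_size b.
    move=> vj hj; apply: leq_ltn_trans (sv j); rewrite vj.
    rewrite -ltnS; apply: leq_trans (term_size_plug_ge s hj).
    by rewrite -add1n leq_add2r term_size_gt0.
  have -> // : r = r'; first apply: (@plug_eq_small _ _ _ b); last by rewrite rb rb'.
  - exact: sr r0 h0.
  - exact: sr r1 hi.
have {ei} := ei i; have [g gu] := no_hole_of_ground hi.
have -> : plug (u i) a = plug (u i) b by exact: no_hole_plug.
move/(plug_eq_small (su i) (sv i)) => <-.
by change (u i = plug (u i) r); rewrite gu /plug subst_of_ground.
Qed.

(** * Irreducible contexts and factorization *)

Definition irreducible p : Prop :=
  [/\ has_hole p, p <> Var tt &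
      forall q r, p = plug q r -> q = Var tt \/ r = Var tt].

(** Plugging at most multiplies sizes, so a result above [n ^ 2] forces both arguments above [n].
    Levi's lemma then makes one context a left factor of the other, and irreducibility makes the
    remainder the hole. *)
Lemma irreducible_unique n p q (a b : ground Om) :
  irreducible p -> irreducible q -> term_size p <= n -> term_size q <= n ->
  n ^ 2 < term_size (plug p a) -> plug p a = plug q b -> p = q /\ a = b.
Proof.
move=> ip iq sp sq sa e.
have large r (c : ground Om) : term_size r <= n -> n ^ 2 < term_size (plug r c) ->
    n < term_size c.
  move=> sr; apply: contraTT; rewrite -!leqNgt => cn.
  by apply: leq_trans (term_size_plug_le r c) _; rewrite -mulnn leq_mul.
have na := large p a sp sa; have nb : n < term_size b by apply: (large q) => //; rewrite -e.
have key r s (c d : ground Om) : irreducible r -> irreducible s ->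
    term_size r <= n -> term_size s <= n -> n < term_size d -> term_size d <= term_size c ->
    plug r c = plug s d -> r = s /\ c = d.
  move=> [hr nr _] [hs ns is_] zr zs zd dc eq.
  have [u su ud] := plug_levi (leq_ltn_trans zr zd) (leq_ltn_trans zs zd) dc hr eq.
  case: (is_ _ _ su) => // uV; move: su ud; rewrite uV plug_id => -> <-.
  by rewrite plug_Var.
case: (leqP (term_size b) (term_size a)) => ab; first exact: key.
by have [-> ->] := key q p b a iq ip sq sp na (ltnW ab) (esym e).
Qed.

(** Strong induction on the size: a reducible context is the composition of two contexts with a
    hole, both strictly smaller. Uniqueness is not claimed; it is needed only for large values. *)
Lemma factorization p : has_hole p ->
  exists ls : seq (term Om unit),
    [/\ p = foldr (@plug unit) (Var tt) ls, size ls < term_size p &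
        forall q, List.In q ls -> irreducible q /\ term_size q <= term_size p].
Proof.
have [n] := ubnP (term_size p); elim: n p => // n IH p sp hp.
case: (classic (p = Var tt)) => [->|np]; first by exists [::].
case: (classic (irreducible p)) => [ip|nip].
  exists [:: p]; split; first by rewrite /= plug_id.
  - by have := term_size_plug_hole (Var tt) hp np; rewrite plug_id.
  - by move=> q /= [<-|].
have [q [r [pE nq nr]]] : exists q r, [/\ p = plug q r, q <> Var tt & r <> Var tt].
  apply: NNPP => h; apply: nip; split=> // q r pE; apply: NNPP => h'; apply: h.
  by exists q, r; split=> // e; apply: h'; [left|right].
have hq : has_hole q.
  move: hp; apply: contraTT => hq; rewrite pE.
  by have [g ->] := no_hole_of_ground hq; rewrite /plug subst_of_ground has_hole_of_ground.
have hr : has_hole r.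
  move: hp; apply: contraTT => hr; rewrite pE.
  have [g ->] := no_hole_of_ground hr.
  have -> : plug q (of_ground unit g) = of_ground unit (plug q g) by rewrite /of_ground subst_plug.
  exact: has_hole_of_ground.
have srp : term_size r < term_size p by rewrite pE; exact: term_size_plug_hole.
have spp := term_size_plug_ge r hq; rewrite -pE in spp.
have sr2 : 1 < term_size r.
  by have := term_size_plug_hole (Var tt) hr nr; rewrite plug_id.
have sqp : term_size q < term_size p.
  by rewrite -ltnS; apply: leq_trans spp; rewrite -addn2 leq_add2l.
have [lq [qE zq aq]] := IH q (leq_trans sqp sp) hq.
have [lr [rE zr ar]] := IH r (leq_trans srp sp) hr.
exists (lq ++ lr); split.
- rewrite pE foldr_cat -rE qE; elim: lq {qE zq aq} => //= l ls <-.
  by rewrite plugA.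
- rewrite size_cat -ltnS; apply: leq_trans spp.
  by rewrite -addSn -addnS leq_add.
- move=> l /List.in_app_iff [/aq|/ar] [il sl]; split=> //.
  + exact: leq_trans sl (ltnW sqp).
  + exact: leq_trans sl (ltnW srp).
Qed.

(** Replacing all variables by the hole yields the context; whether a hole remains separates the two
    cases. *)
Lemma unary_term k (t : term Om 'I_k) : #|vars t| <= 1 ->
  (exists2 g : ground Om, term_size g = term_size t &
     forall W (s : 'I_k -> term Om W), subst s t = of_ground W g)
  \/ (exists p y, [/\ has_hole p, term_size p = term_size t,
       y \in vars t & forall W (s : 'I_k -> term Om W), subst s t = plug p (s y)]).
Proof.
pose p := subst (fun _ => Var tt) t => h.
have sz : term_size p = term_size t.
  rewrite /p; elim/term_nested_ind: t {h p} => //= f a IH; congr S.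
  by apply: eq_bigr => i _; rewrite ffunE IH.
have [[y hy]|hy] : (exists y, y \in vars t) \/ vars t = set0.
  by case: (set_0Vmem (vars t)) => [->|[y hy]]; [right|left; exists y].
- right; exists p, y.
  have e W (s : 'I_k -> term Om W) : subst s t = plug p (s y).
    rewrite /plug /p subst_comp; apply: eq_subst_vars => x xt.
    by congr s; apply: (card_le1_eqP h).
  split=> //; rewrite /p; elim/term_nested_ind: t hy {h p sz e} => //= f a IH.
  case/bigcupP => i _ /IH hi; apply/existsP; exists i; by rewrite ffunE.
- left; have : ~~ has_hole p.
    rewrite /p; elim/term_nested_ind: t hy {h p sz} => [x /setP/(_ x)|f a IH] /=.
      by rewrite !inE eqxx.
    move=> /eqP e; apply/existsPn => i; rewrite ffunE; apply: IH.
    by apply/eqP; rewrite -subset0 -(eqP e); exact: bigcup_sup.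
  case/no_hole_of_ground => g pg; exists g.
    by rewrite -sz pg term_size_of_ground.
  move=> W s; rewrite -(@subst_of_ground unit _ (fun=> of_ground W g) g) -pg /p subst_comp.
  by apply: eq_subst_vars => x; rewrite hy inE.
Qed.

End Substitution.

(** * Spans closed under bilinear rules *)

Section SpanSaturation.
Import GRing.Theory.
Local Open Scope ring_scope.
Variables (F : fieldType) (V : vectType F) (I : eqType) (rs : seq I).
Variable B : I -> V -> V -> V.
Hypothesis B_linl : forall i z, linear (B i ^~ z).
Hypothesis B_linr : forall i y, linear (B i y).

Definition bilinear_step (L : seq V) : seq V :=
  L ++ flatten [seq flatten [seq [seq B i y z | z <- L] | y <- L] | i <- rs].

(** Linearity is a predicate on a plain function here, so the lemma applies to both partial
    applications of a bilinear map. *)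
Lemma span_linear_sub (U : vectType F) (f : V -> U) (X : seq V) (W : {vspace U}) : linear f ->
  (forall x, x \in X -> f x \in W) -> forall y, y \in <<X>>%VS -> f y \in W.
Proof.
move=> lf; elim: X => [|x X IH] hX y.
  rewrite span_nil memv0 => /eqP ->.
  by have := lf (-1) 0 0; rewrite scaler0 addr0 scaleN1r addNr => ->; exact: mem0v.
rewrite span_cons => /memv_addP [_ /vlineP [a ->] [z hz ->]].
rewrite lf; apply: rpredD; first by apply/rpredZ/hX/mem_head.
by apply: IH hz => w hw; apply: hX; rewrite in_cons hw orbT.
Qed.

Lemma span_bilinear_step (L L' : seq V) :
  (<<L>> <= <<L'>>)%VS -> (<<bilinear_step L>> <= <<bilinear_step L'>>)%VS.
Proof.
move=> sLL; apply/span_subvP => x; rewrite mem_cat => /orP [xL|].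
  have : x \in <<L'>>%VS by apply: (subvP sLL); exact: memv_span.
  by apply/subvP/sub_span => y yL; rewrite mem_cat yL.
case/flatten_mapP => i ri /flatten_mapP [y yL /mapP [z zL ->]].
have yL' : y \in <<L'>>%VS by apply: (subvP sLL); exact: memv_span.
have zL' : z \in <<L'>>%VS by apply: (subvP sLL); exact: memv_span.
apply: (span_linear_sub (B_linl i z)) yL' => {yL}y yL.
apply: (span_linear_sub (B_linr i y)) zL' => {zL}z zL.
apply: memv_span; rewrite mem_cat; apply/orP; right.
by apply/flatten_mapP; exists i => //; apply/flatten_mapP; exists y => //; exact: map_f.
Qed.

(** The span after a round depends only on the span before it, so the increasing chain of spans is
    stationary from its first repetition on; the dimension forces a repetition within [n] rounds. *)
Lemma span_saturation (L : seq V) n h : (\dim {:V} <= n)%N ->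
  (<<iter h bilinear_step L>> <= <<iter n bilinear_step L>>)%VS.
Proof.
move=> dn; pose U j := <<iter j bilinear_step L>>%VS.
have U1 j : (U j <= U j.+1)%VS.
  by apply/sub_span => x; rewrite /= mem_cat => ->.
have Ule i j : (i <= j)%N -> (U i <= U j)%VS.
  elim: j => [|j IH]; first by rewrite leqn0 => /eqP ->.
  by rewrite leq_eqVlt => /predU1P [-> //|/IH h1]; exact: subv_trans h1 (U1 j).
have [j jn jU] : exists2 j, (j <= n)%N & (U j.+1 <= U j)%VS.
  case: (boolP [exists j : 'I_n.+1, (U j.+1 <= U j)%VS]).
    by case/existsP => j hj; exists (val j); rewrite // -ltnS ltn_ord.
  rewrite negb_exists => /forallP nU.
  (* Under strict growth each [U j] with [j <= n.+1] has dimension at least [j], so [U n.+1] would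
     exceed the whole space. *)
  suff : (n.+1 <= \dim (U n.+1))%N.
    by rewrite leqNgt ltnS (leq_trans _ dn) // dimvS // subvf.
  elim: {-2}n.+1 (leqnn n.+1) => // j IH jn; apply: leq_ltn_trans (IH (ltnW jn)) _.
  rewrite ltnNge; apply/negP => hd; have /negP := nU (Ordinal jn); apply=> /=.
  by have := eqEdim (U j) (U j.+1); rewrite U1 hd /= => /eqP <-; exact: subvv.
have Uj i : (U (j + i)%N <= U j)%VS.
  elim: i => [|i IH]; first by rewrite addn0 subvv.
  by rewrite addnS; apply: subv_trans jU; exact: span_bilinear_step IH.
case: (leqP h j) => hj; first exact: subv_trans (Ule _ _ hj) (Ule _ _ jn).
by rewrite -(subnKC (ltnW hj)); apply: subv_trans (Uj _) (Ule _ _ jn).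
Qed.

End SpanSaturation.

Lemma dim_ffun_matrix (F : fieldType) c d :
  \dim {: {ffun 'I_c -> 'M[F]_d}} = c * (d * d).
Proof. by rewrite dimvf /dim /= card_ord. Qed.

(** * Linear representation of values *)

Import GRing.Theory Num.Theory.

Section Values.
Variables (Om : signature) (n : nat).
Variables (Ls : seq (term Om unit)) (K : seq (ground Om)).
Hypothesis Ls_irr : forall p, p \in Ls -> irreducible p /\ term_size p <= n.
Hypothesis K_small : forall g, g \in K -> term_size g <= n ^ 2.

Inductive value : ground Om -> Prop :=
| value_base g : g \in K -> value g
| value_plug p v : p \in Ls -> value v -> value (plug p v).

Fixpoint values_upto (j : nat) : seq (ground Om) :=
  if j is i.+1
  then values_upto i ++ [seq plug p v | p <- Ls, v <- values_upto i] else K.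

Lemma size_values_upto j : size (values_upto j) = (size Ls).+1 ^ j * size K.
Proof.
elim: j => [|j IH]; first by rewrite expn0 mul1n.
by rewrite size_cat size_allpairs IH expnS -mulnA mulSn.
Qed.

Lemma values_upto_le i j : i <= j -> {subset values_upto i <= values_upto j}.
Proof.
elim: j => [|j IH]; first by rewrite leqn0 => /eqP -> v.
rewrite leq_eqVlt => /predU1P [-> v //|/IH h v /h hv].
by rewrite /= mem_cat hv.
Qed.

Lemma plug_bigger p (v : ground Om) : p \in Ls -> term_size v < term_size (plug p v).
Proof. by case/Ls_irr => -[hp np _] _; exact: term_size_plug_hole. Qed.

(** Each letter enlarges the value, so the number of letters is at most the size. *)
Lemma value_upto v : value v -> v \in values_upto (term_size v).
Proof.
elim=> {v} [g gK|p v pL hv IH]; first exact: (@values_upto_le 0).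
have := plug_bigger v pL; case E : (term_size (plug p v)) => [//|m] hm.
rewrite /= mem_cat; apply/orP; right; apply: allpairs_f => //.
by apply: values_upto_le IH.
Qed.

(** The values to which [irreducible_unique] does not apply; they are tracked one by one. By
    [value_upto], none of them is missed. *)
Definition small_values : seq (ground Om) :=
  undup [seq v <- values_upto (n ^ 2) | term_size v <= n ^ 2].

Lemma mem_small v : value v -> term_size v <= n ^ 2 -> v \in small_values.
Proof.
move=> hv sv; rewrite mem_undup mem_filter sv; apply: values_upto_le sv _ _.
exact: value_upto.
Qed.

Lemma small_valuesP (v : ground Om) : v \in small_values -> term_size v <= n ^ 2.
Proof. by rewrite mem_undup mem_filter => /andP []. Qed.

Lemma size_small : size small_values <= (size Ls).+1 ^ (n ^ 2) * size K.
Proof.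
apply: leq_trans (size_undup _) _; rewrite size_filter.
by rewrite -size_values_upto count_size.
Qed.

(** Exceeds every index of a letter and every leading digit, so a small value has a numeral below
    [base] and a large value one that is at least [base]. *)
Definition base : nat := size small_values + size Ls + 2.

(* Horner numerals in base [base]: the outermost letter is the last digit, and
   the innermost, small value is the first. *)
Inductive numeral : ground Om -> nat -> Prop :=
| numeral_small v : value v -> term_size v <= n ^ 2 ->
    numeral v (index v small_values).+1
| numeral_large p v m : p \in Ls -> numeral v m ->
    n ^ 2 < term_size (plug p v) ->
    numeral (plug p v) (base * m + index p Ls).

Lemma numeral_gt0 v m : numeral v m -> 0 < m.
Proof. by elim=> // p {}v k _ _ hk _; rewrite addn_gt0 muln_gt0 hk /base addn2. Qed.

Lemma letter_unique p q (v w : ground Om) : p \in Ls -> q \in Ls ->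
  n ^ 2 < term_size (plug p v) -> plug p v = plug q w -> p = q /\ v = w.
Proof.
move=> /Ls_irr [ip sp] /Ls_irr [iq sq]; exact: irreducible_unique.
Qed.

(** The size decides which rule applies, and a large value determines its outermost letter. *)
Lemma numeral_fun v m m' : numeral v m -> numeral v m' -> m = m'.
Proof.
move=> h; elim: h m' => {v m} [v hv sv|p v m pL _ IH sv] m' h.
  case E : _ _ / h => [//|p w k _ _ sw].
  by move: sw; rewrite -E ltnNge sv.
case E : _ _ / h => [w _ sw|q w k qL hw _]; first by move: sv; rewrite E ltnNge sw.
have [Eq Ew] := letter_unique pL qL sv E.
by rewrite -Eq (IH k) // Ew.
Qed.

Lemma index_letter p : p \in Ls -> index p Ls < base.
Proof.
rewrite -index_mem => h; apply: leq_trans h _.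
by rewrite /base -addnA addnCA leq_addr.
Qed.

(** Comparison with [base] separates small from large values; for large ones, division by [base]
    recovers the outermost letter and the numeral of the rest. *)
Lemma numeral_inj v w m : numeral v m -> numeral w m -> v = w.
Proof.
have small_base u : value u -> term_size u <= n ^ 2 ->
    (index u small_values).+1 < base.
  move=> hu su; have := mem_small hu su; rewrite -index_mem => h.
  apply: leq_ltn_trans h _; rewrite /base -addnA.
  by rewrite -[X in X < _]addn0 ltn_add2l addn2.
have large_base k j : 0 < k -> base <= base * k + j.
  by move=> hk; rewrite (leq_trans _ (leq_addr _ _)) // leq_pmulr.
move=> h; elim: h w => {v m} [v hv sv|p v m pL hm IH sv] w h.
  case E: _ / h => [u hu su|q u k qL hk su].
    case: E => E; rewrite -[v](nth_index v (mem_small hv sv)) E.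
    by rewrite nth_index // mem_small.
  by have := small_base v hv sv; rewrite E ltnNge large_base // (numeral_gt0 hk).
case E: _ / h => [u hu su|q u k qL hk su].
  by have := small_base u hu su; rewrite -E ltnNge large_base // (numeral_gt0 hm).
have b0 : 0 < base by rewrite /base addn2.
have Em : m = k.
  by have := congr1 (divn^~ base) E; rewrite /= !(mulnC base) !divnMDl //
    !divn_small ?index_letter // !addn0.
have Ep : index p Ls = index q Ls by move/eqP: E; rewrite Em eqn_add2l => /eqP.
have -> : p = q by rewrite -[p](nth_index p pL) Ep nth_index.
by rewrite (IH u) // Em.
Qed.

Lemma numeral_total v : value v -> exists m, numeral v m.
Proof.
elim=> {v} [g gK|p v pL hv [m hm]].
  by eexists; apply: numeral_small; [exact: value_base|exact: K_small].
case: (leqP (term_size (plug p v)) (n ^ 2)) => h.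
  by eexists; apply: numeral_small h; exact: value_plug.
by eexists; exact: numeral_large hm h.
Qed.

(** Meaningful on values only; it serves the proof and is not part of the algorithms. *)
Definition num (v : ground Om) : nat := epsilon (inhabits 0) (numeral v).

Lemma numP v : value v -> numeral v (num v).
Proof. by move/numeral_total; exact: epsilon_spec. Qed.

Lemma num_inj v w : value v -> value w -> num v = num w -> v = w.
Proof. by move=> /numP hv /numP hw E; move: hw; rewrite -E; exact: numeral_inj. Qed.

Lemma num_plug p v : p \in Ls -> value v -> n ^ 2 < term_size (plug p v) ->
  num (plug p v) = base * num v + index p Ls.
Proof.
move=> pL hv sv; apply: numeral_fun (numP (value_plug pL hv)) _.
by apply: numeral_large => //; exact: numP.
Qed.

(** * States as vectors and assignments as matrices *)

Variable k : nat.
Local Notation state := (state Om k).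
Local Open Scope ring_scope.

Definition value_state (s : state) : Prop := forall x, value (s x).

(** The constant coordinate [None] turns affine maps into linear ones; the indicators of small
    values provide the corrections to the affine formula. *)
Definition coordinate : finType :=
  option ('I_k * option 'I_(size small_values)).

Definition coord_val (s : state) (j : coordinate) : rat :=
  match j with
  | None => 1
  | Some (x, None) => (num (s x))%:R
  | Some (x, Some i) => (s x == tnth (in_tuple small_values) i)%:R
  end.

Local Notation d := #|coordinate|.

Definition state_vec (s : state) : 'cV[rat]_d :=
  \col_i coord_val s (enum_val i).

Definition linear_obs (F : state -> rat) : Prop :=
  exists r : 'rV[rat]_d,
    forall s, value_state s -> F s = (r *m state_vec s) 0 0.

Lemma linear_coord j : linear_obs (coord_val^~ j).
Proof.
exists (delta_mx 0 (enum_rank j)) => s _.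
by rewrite -rowE !mxE enum_rankK.
Qed.

Lemma linear_ext F G : (forall s, value_state s -> F s = G s) ->
  linear_obs F -> linear_obs G.
Proof. by move=> e [r hr]; exists r => s hs; rewrite -e // hr. Qed.

Lemma linear_add F G :
  linear_obs F -> linear_obs G -> linear_obs (fun s => F s + G s).
Proof.
by case=> r hr [q hq]; exists (r + q) => s hs; rewrite mulmxDl mxE -hr -?hq.
Qed.

Lemma linear_scale c F : linear_obs F -> linear_obs (fun s => c * F s).
Proof.
by case=> r hr; exists (c *: r) => s hs; rewrite -scalemxAl mxE -hr.
Qed.

Lemma linear_const c : linear_obs (fun=> c).
Proof.
apply: (linear_ext (F := fun s => c * coord_val s None)).
  by move=> s _; rewrite mulr1.
exact/linear_scale/linear_coord.
Qed.

Lemma linear_sum (I : finType) (F : I -> state -> rat) :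
  (forall i, linear_obs (F i)) -> linear_obs (fun s => \sum_i F i s).
Proof.
move=> h; elim: (index_enum I) => [|i r IH].
  by apply: linear_ext (linear_const 0) => s _; rewrite big_nil.
by apply: linear_ext (linear_add (h i) IH) => s _; rewrite big_cons.
Qed.

(** The number and the indicators are carried together: after plugging a letter, the new number
    depends linearly on the old number and the old indicators. *)
Definition linear_value (u : state -> ground Om) : Prop :=
  [/\ forall s, value_state s -> value (u s),
      linear_obs (fun s => (num (u s))%:R) &
      forall i, linear_obs (fun s => (u s == tnth (in_tuple small_values) i)%:R)].

Lemma linear_value_var x : linear_value (fun s => s x).
Proof.
split=> [s||i]; first exact.
- exact: (linear_coord (Some (x, None))).
- exact: (linear_coord (Some (x, Some _))).
Qed.

Lemma linear_value_const g : g \in K -> linear_value (fun=> g).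
Proof.
by move=> gK; split=> [s _||i]; [exact: value_base|exact: linear_const|exact: linear_const].
Qed.

(** On large results, plugging [p] appends a digit, an affine map. The finitely many small results
    deviate from it by constants, each multiplied by the indicator of the small argument
    concerned. *)
Lemma linear_value_plug p u : p \in Ls -> linear_value u ->
  linear_value (fun s => plug p (u s)).
Proof.
move=> pL [hu nu su]; have [[hp np _] _] := Ls_irr pL.
set sm := small_values in su *; split=> [s hs||i].
- exact/value_plug/hu.
- pose c : rat := base%:R; pose e : rat := (index p Ls)%:R.
  pose v j := tnth (in_tuple sm) j.
  (* The error of the affine formula at the small value [v j]; it vanishes if the result is already
     large. *)
  pose delta j : rat := if (term_size (plug p (v j)) <= n ^ 2)%N
    then (num (plug p (v j)))%:R - (c * (num (v j))%:R + e) else 0.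
  apply: (linear_ext (F := fun s => c * (num (u s))%:R +
    (e + \sum_j delta j * (u s == v j)%:R))); last first.
    apply: linear_add; first exact: linear_scale.
    apply: linear_add; first exact: linear_const.
    by apply: linear_sum => j; apply: linear_scale; exact: su.
  have vI : injective v by apply/tuple_uniqP; exact: undup_uniq.
  move=> s hs; have vs := hu s hs.
  have large : (n ^ 2 < term_size (plug p (u s)))%N ->
      (num (plug p (u s)))%:R = c * (num (u s))%:R + e :> rat.
    by move=> h; rewrite num_plug // natrD natrM.
  case: (leqP (term_size (u s)) (n ^ 2)) => sz.
    have /tnthP [j uj] : u s \in in_tuple sm by exact: mem_small.
    rewrite (bigD1 j) //= big1 => [|l lj]; last first.
      rewrite uj (inj_eq vI) eq_sym (negPf lj).
      by rewrite mulr0.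
    rewrite addr0 /v -uj eqxx mulr1 /delta /v -uj.
    case: leqP => h; last by rewrite addr0 large.
    by rewrite addrA addrC subrK.
  rewrite big1 => [|j _].
    by rewrite addr0 large // (leq_trans sz) // ltnW // plug_bigger.
  rewrite (_ : (u s == v j) = false) ?mulr0 //; apply/negP => /eqP E.
  by move: sz; rewrite E ltnNge small_valuesP // mem_tnth.
- set w := tnth _ i.
  have sw : (term_size w <= n ^ 2)%N by apply: small_valuesP; exact: mem_tnth.
  (* Plugging [p] is injective: the indicator of [w] becomes that of its only preimage, which is
     again small, or zero if there is none. *)
  case: (classic (exists2 v, value v & plug p v = w)) => [[v hv vw]|nv].
    have : v \in in_tuple sm.
      by apply: mem_small => //; rewrite (leq_trans _ sw) // -vw ltnW // plug_bigger.
    case/tnthP => j vj; apply: linear_ext (su j) => s hs.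
    by rewrite -vj -vw (inj_eq (plug_inj hp)).
  apply: linear_ext (linear_const 0) => s hs.
  case: eqP => // E; case: nv; exists (u s) => //; exact: hu.
Qed.

Definition covered (t : term Om 'I_k) : Prop :=
  (exists2 g, g \in K & forall s : state, subst s t = g) \/
  (exists ls x, {subset ls <= Ls} /\
     forall s : state, subst s t = foldr (@plug Om void) (s x) ls).

Lemma linear_value_subst t : covered t -> linear_value (fun s => subst s t).
Proof.
have ext u w : (forall s, u s = w s) -> linear_value u -> linear_value w.
  move=> e [h1 h2 h3]; split=> [s hs||i]; first by rewrite -e; exact: h1.
  - by apply: linear_ext h2 => s _; rewrite e.
  - by apply: linear_ext (h3 i) => s _; rewrite e.
case=> [[g gK e]|[ls [x [sL e]]]].
  by apply: ext (linear_value_const gK) => s; rewrite e.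
apply: (ext (fun s => foldr (@plug Om void) (s x) ls)) => [s|]; first by rewrite e.
elim: ls sL {e} => [|p ls IH] sL; first exact: linear_value_var.
apply: linear_value_plug; first by apply: sL; rewrite mem_head.
by apply: IH => q qls; apply: sL; rewrite in_cons qls orbT.
Qed.

Definition apply_subst (r : 'I_k -> term Om 'I_k) (s : state) : state :=
  [ffun x => subst s (r x)].

(** Preservation of value states is included so that matrices of successive substitutions can be
    multiplied. *)
Definition represents (r : 'I_k -> term Om 'I_k) (M : 'M[rat]_d) : Prop :=
  forall s, value_state s -> value_state (apply_subst r s) /\
    M *m state_vec s = state_vec (apply_subst r s).

Lemma covered_represents r : (forall x, covered (r x)) -> exists M, represents r M.
Proof.
move=> hr; have lv x := linear_value_subst (hr x).
have : forall j : coordinate, linear_obs (fun s => coord_val (apply_subst r s) j).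
  case=> [[x [i|]]|]; last exact: linear_const.
  - have [_ _ /(_ i)] := lv x; apply: linear_ext => s _; by rewrite /= ffunE.
  - have [_ + _] := lv x; apply: linear_ext => s _; by rewrite /= ffunE.
case/fin_all_exists => R hR.
exists (\matrix_(i, l) R (enum_val i) 0 l) => s hs; split.
  by move=> x; rewrite ffunE; have [h _ _] := lv x; exact: h.
apply/matrixP => i l; rewrite ord1 [RHS]mxE hR // !mxE.
by apply: eq_bigr => m _; rewrite !mxE.
Qed.

End Values.

(** * Facts derived by rules *)

Lemma In_mem (T : eqType) (x : T) s : List.In x s <-> x \in s.
Proof.
elim: s => //= y s IH; rewrite in_cons; split.
  by case=> [->|/IH ->]; rewrite ?eqxx ?orbT.
by case/predU1P => [->|/IH]; [left|right].
Qed.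

Lemma In_map (S T : Type) (F : S -> T) s y :
  List.In y [seq F x | x <- s] <-> exists2 x, List.In x s & y = F x.
Proof.
elim: s => [|x s IH] /=; first by split=> // -[].
rewrite IH; split=> [[<-|[z zs ->]]|[z [<-|zs] ->]].
- by exists x => //; left.
- by exists z => //; right.
- by left.
- by right; exists z.
Qed.

Lemma In_flatmap (S T : Type) (F : S -> seq T) s y :
  List.In y (flatten [seq F x | x <- s]) <->
  exists2 x, List.In x s & List.In y (F x).
Proof.
elim: s => [|x s IH] /=; first by split=> // -[].
rewrite List.in_app_iff IH; split=> [[h|[z zs h]]|[z [<-|zs] h]].
- by exists x => //; left.
- by exists z => //; right.
- by left.
- by right; exists z.
Qed.

(* A rule [(A, B, C)], coded as a tree, combines a fact labelled [A] with a
   fact labelled [B] into a fact labelled [C]. *)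
Definition rule (A B C : tree) : tree := Node A (Node B C).
Definition rule_fst (r : tree) : tree := lchild r.
Definition rule_snd (r : tree) : tree := lchild (rchild r).
Definition rule_res (r : tree) : tree := rchild (rchild r).

Section Facts.
Variables (Om : signature) (k : nat).
Local Notation tm := (term Om 'I_k).
Local Notation substitution := ('I_k -> tm).
Definition fact : Type := (tree * substitution)%type.

(* First [r], then [q]. *)
Definition seq_subst (r q : substitution) : substitution :=
  fun x => subst r (q x).

Definition derive (rules : seq tree) (fs : seq fact) : seq fact :=
  fs ++ flatten [seq flatten [seq flatten [seq
    (if (rule_fst r == f.1) && (rule_snd r == g.1)
     then [:: (rule_res r, seq_subst f.2 g.2)] else [::])
    | g <- fs] | f <- fs] | r <- rules].

Lemma In_derive rules fs f : List.In f (derive rules fs) <->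
  List.In f fs \/ exists r g h, [/\ r \in rules, List.In g fs, List.In h fs,
    rule_fst r = g.1 /\ rule_snd r = h.1 &
    f = (rule_res r, seq_subst g.2 h.2)].
Proof.
rewrite List.in_app_iff; split=> -[h|h]; [by left|right|by left|right].
  case/In_flatmap: h => r /In_mem rr /In_flatmap [g gf] /In_flatmap [h hf].
  case: ifP => // /andP [/eqP e1 /eqP e2] [<-|//].
  by exists r, g, h.
case: h => r [g [h [rr gf hf [e1 e2] ->]]].
apply/In_flatmap; exists r; first exact/In_mem.
apply/In_flatmap; exists g => //; apply/In_flatmap; exists h => //.
by rewrite e1 e2 !eqxx /=; left.
Qed.

Lemma apply_seq_subst r q (s : state Om k) :
  apply_subst (seq_subst r q) s = apply_subst q (apply_subst r s).
Proof.
apply/ffunP => x; rewrite !ffunE /seq_subst subst_comp.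
by apply: eq_subst => y; rewrite ffunE.
Qed.

Lemma covered_mono (Ls Ls' : seq (term Om unit)) (K K' : seq (ground Om)) (t : tm) :
  {subset Ls <= Ls'} -> {subset K <= K'} -> covered Ls K t -> covered Ls' K' t.
Proof.
move=> sL sK [[g gK e]|[ls [x [sls e]]]]; [left|right].
  by exists g => //; exact: sK.
by exists ls, x; split=> // p pls; exact/sL/sls.
Qed.

(** Collects the irreducible factors of the contexts and the ground terms. A factorization has fewer
    factors than the size of its context, which bounds the alphabet by the total size. *)
Lemma covering (n : nat) (Ts : seq tm) :
  (forall t, t \in Ts -> #|vars t| <= 1 /\ term_size t <= n) ->
  exists (Ls : seq (term Om unit)) (K : seq (ground Om)),
  [/\ forall p, p \in Ls -> irreducible p /\ term_size p <= n,
      forall g, g \in K -> term_size g <= n,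
      size Ls <= \sum_(t <- Ts) term_size t,
      size K <= \sum_(t <- Ts) term_size t &
      forall t, t \in Ts -> covered Ls K t].
Proof.
elim: Ts => [|t Ts IH] hT; first by exists [::], [::].
case: IH => [u uT|Ls [K [hL hK sL sK cov]]].
  by apply: hT; rewrite in_cons uT orbT.
have [ut st] := hT t (mem_head _ _); rewrite big_cons.
have cons (Ls' : seq (term Om unit)) (K' : seq (ground Om)) u :
    {subset Ls <= Ls'} -> {subset K <= K'} -> covered Ls' K' t ->
    u \in t :: Ts -> covered Ls' K' u.
  move=> s1 s2 ht; rewrite in_cons => /predU1P [-> //|/cov].
  exact: covered_mono.
case: (unary_term ut) => [[g sg e]|[p [y [hp sp _ e]]]].
  exists Ls, (g :: K); split=> //.
  - by move=> h; rewrite in_cons => /predU1P [->|/hK //]; rewrite sg.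
  - by rewrite (leq_trans sL) // leq_addl.
  - by rewrite /= -add1n leq_add // term_size_gt0.
  - move=> u; apply: cons => //; first by move=> h hk; rewrite in_cons hk orbT.
    by left; exists g; [rewrite mem_head|move=> s; rewrite e of_ground_void].
have [ls [pE sls als]] := factorization hp.
exists (ls ++ Ls), K; split=> //.
- move=> q; rewrite mem_cat => /orP [/In_mem/als [iq sq]|/hL //].
  by split=> //; rewrite (leq_trans sq) // sp.
- by rewrite size_cat leq_add // -sp ltnW.
- by rewrite (leq_trans sK) // leq_addl.
move=> u; apply: cons => //; first by move=> q qL; rewrite mem_cat qL orbT.
right; exists ls, y; split=> [q ql|s]; first by rewrite mem_cat ql.
rewrite e {1}pE; elim: (ls) => //= q l <-.
by rewrite plugA.
Qed.

(* The facts span a space of dimension (number of labels) * d ^ 2, where d is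
   the dimension of the space of states. *)
Definition height_bound (n : nat) : nat :=
  (n + n + 1) * (1 + n * ((n + 1) ^ (n ^ 2) * n + 1)) ^ 2.

Definition fact_size (f : fact) : nat := \sum_x term_size (f.2 x).

(** Facts become vectors and a round of derivation becomes [bilinear_step]; the equality holds after
    a fact exactly if a linear form vanishes on its vector. By [span_saturation], vanishing up to
    the bound propagates to every height. *)
Theorem saturation (rules : seq tree) (fs : seq fact) (s0 : state Om k)
    (A B : tm) (n : nat) (rho : tree) :
  (forall f x, List.In f fs -> #|vars (f.2 x)| <= 1) ->
  #|vars A| <= 1 -> #|vars B| <= 1 ->
  k <= n -> size rules <= n -> size fs <= n ->
  \sum_(f <- fs) fact_size f + (\sum_x term_size (s0 x)) +
    (term_size A + term_size B) <= n ->
  (forall r, List.In (rho, r) (iter (height_bound n) (derive rules) fs) ->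
     holds (apply_subst r s0) (A, B)) ->
  forall h r, List.In (rho, r) (iter h (derive rules) fs) ->
     holds (apply_subst r s0) (A, B).
Proof.
move=> ufs uA uB kn rn fn sn hyp h r0 hr0.
pose Ts := flatten [seq [seq f.2 x | x <- enum 'I_k] | f <- fs] ++ [:: A; B].
have sTs : \sum_(t <- Ts) term_size t =
    \sum_(f <- fs) fact_size f + (term_size A + term_size B).
  rewrite big_cat /= !big_cons big_nil addn0; congr (_ + _).
  rewrite big_flatten big_map; apply: eq_bigr => f _.
  by rewrite big_map big_enum.
have TsP t : t \in Ts -> #|vars t| <= 1 /\ term_size t <= n.
  move=> tT; split; last first.
    apply: leq_trans sn; rewrite addnAC -sTs.
    apply: leq_trans (leq_addr _ _).
    by rewrite (big_rem t) //= leq_addr.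
  move/In_mem: tT => /List.in_app_iff [/In_flatmap [f ff /In_map [x _ ->]]|].
    exact: ufs.
  by move=> /= [<-|[<-|]].
have [Ls [K0 [hL hK0 sL sK0 cov0]]] := covering TsP.
(* The initial values join the constants, which makes [s0] a value state. *)
pose K := K0 ++ [seq s0 x | x <- enum 'I_k].
have nn2 : n <= n ^ 2 by case: (n) => // m; rewrite -mulnn leq_pmulr.
have hK g : g \in K -> term_size g <= n ^ 2.
  rewrite mem_cat => /orP [/hK0 h1|/mapP [x _ ->]]; first exact: leq_trans h1 nn2.
  apply: leq_trans nn2; apply: leq_trans sn.
  rewrite -addnA addnCA; apply: leq_trans (leq_addr _ _).
  by rewrite (bigD1 x) //= leq_addr.
have cov t : t \in Ts -> covered Ls K t.
  by move=> /cov0; apply: covered_mono => // g gK; rewrite mem_cat gK.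
have sLn : size Ls <= n.
  apply: leq_trans sL _; apply: leq_trans sn.
  by rewrite sTs addnAC leq_addr.
have sKn : size K <= n.
  rewrite size_cat size_map size_enum_ord; apply: leq_trans sn.
  rewrite addnAC -sTs leq_add //.
  rewrite -[X in X <= _]card_ord -sum1_card leq_sum // => x _.
  exact: term_size_gt0.
have vs0 : value_state Ls K s0.
  by move=> x; apply: value_base; rewrite mem_cat map_f ?orbT // mem_enum.
set d := #|coordinate n Ls K k|.
pose c := size rules + size fs.
pose labs := [seq rule_res r | r <- rules] ++ [seq f.1 | f <- fs].
have slabs : size labs = c by rewrite size_cat !size_map.
(* Labels outside [labs] share the spare last index [c], whence the type with [c.+1] elements. *)
pose ix a : 'I_c.+1 := inord (index a labs).
have ixP a b : a \in labs -> (ix a == ix b) = (a == b).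
  move=> al; apply/eqP/eqP => [|-> //] /(congr1 val).
  rewrite /= !inordK ?ltnS -?slabs ?index_size // => E.
  rewrite -(nth_index Leaf al) E nth_index // -index_mem -E index_mem //.
pose V := {ffun 'I_c.+1 -> 'M[rat]_d}.
(* The fact labelled [a] whose substitution has the matrix [M] becomes the vector
   [delta a M]; a rule then acts as the bilinear map [Bl r]. *)
pose delta a (M : 'M[rat]_d) : V := [ffun i => if i == ix a then M else 0%R].
pose Bl r (y z : V) : V := [ffun i => if i == ix (rule_res r)
  then (z (ix (rule_snd r)) *m y (ix (rule_fst r)))%R else 0%R].
have Bll r z : linear (Bl r ^~ z).
  move=> a u v; apply/ffunP => i; rewrite !ffunE; case: ifP => _.
    by rewrite mulmxDr scalemxAr.
  by rewrite scaler0 addr0.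
have Blr r y : linear (Bl r y).
  move=> a u v; apply/ffunP => i; rewrite !ffunE; case: ifP => _.
    by rewrite mulmxDl scalemxAl.
  by rewrite scaler0 addr0.
pose sim (f : fact) (x : V) :=
  exists2 M, represents f.2 M & x = delta f.1 M.
have fs_sim f : List.In f fs -> exists x, sim f x.
  move=> ff; have [] := @covered_represents Om n Ls K hL hK k f.2.
    move=> x; apply: cov; rewrite mem_cat; apply/orP; left.
    by apply/In_mem/In_flatmap; exists f => //; apply/In_mem/map_f; exact: mem_enum.
  by move=> M hM; exists (delta f.1 M), M.
have [L0 [L0a L0b]] : exists L0 : seq V,
    (forall f, List.In f fs -> exists2 x, x \in L0 & sim f x) /\
    (forall x, x \in L0 -> exists2 f, List.In f fs & sim f x).
  elim: (fs) fs_sim => [|f s IH] hs; first by exists [::].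
  have [L [h1 h2]] := IH (fun g gs => hs g (or_intror gs)).
  have [x hx] := hs f (or_introl erefl).
  exists (x :: L); split=> [g [<-|/h1 [y yL hy]]|y].
  - by exists x; rewrite ?mem_head.
  - by exists y => //; rewrite in_cons yL orbT.
  rewrite in_cons => /predU1P [->|/h2 [g gs hg]]; first by exists f => //; left.
  by exists g => //; right.
pose Fh j := iter j (derive rules) fs.
pose Lh j := iter j (bilinear_step rules Bl) L0.
have labF j f : List.In f (Fh j) -> f.1 \in labs.
  elim: j f => [|j IH] f.
    by move=> ff; rewrite mem_cat; apply/orP; right; apply/In_mem/In_map; exists f.
  case/In_derive => [/IH //|[r [g [e [rr _ _ _ ->]]]]].
  by rewrite mem_cat map_f.
(* [bilinear_step] applies a rule to all pairs of vectors; pairs with the wrong labels contribute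
   only the zero vector. *)
have Bsim r f g x y : f.1 \in labs -> g.1 \in labs ->
    sim f x -> sim g y ->
    if (rule_fst r == f.1) && (rule_snd r == g.1)
    then sim (rule_res r, seq_subst f.2 g.2) (Bl r x y) else Bl r x y = 0%R.
  move=> fl gl [M hM ->] [N hN ->].
  case: ifP => [/andP [/eqP e1 /eqP e2]|ne].
    exists (N *m M)%R.
      move=> s vs; have [v1 E1] := hM s vs; have [v2 E2] := hN _ v1.
      by rewrite /= apply_seq_subst -mulmxA E1 E2.
    by apply/ffunP => i; rewrite !ffunE e1 e2 !eqxx.
  apply/ffunP => i; rewrite !ffunE; case: ifP => // _.
  rewrite [ix (rule_fst r) == _]eq_sym [ix (rule_snd r) == _]eq_sym !ixP //.
  rewrite ![_.1 == _]eq_sym; move: ne.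
  by case: (_ == f.1); case: (_ == g.1); rewrite //= ?mulmx0 ?mul0mx.
have simF j f : List.In f (Fh j) -> exists2 x, x \in Lh j & sim f x.
  elim: j f => [|j IH] f; first exact: L0a.
  case/In_derive => [/IH [x xL hx]|].
    by exists x => //; rewrite /= mem_cat xL.
  case=> r [g [e [rr gf ef [e1 e2] ->]]].
  have [x xL hx] := IH g gf; have [y yL hy] := IH e ef.
  exists (Bl r x y).
    rewrite /= mem_cat; apply/orP; right; apply/flatten_mapP; exists r => //.
    by apply/flatten_mapP; exists x => //; exact: map_f.
  have := Bsim r g e x y (labF _ _ gf) (labF _ _ ef) hx hy.
  by rewrite e1 e2 !eqxx.
have simL j x : x \in Lh j -> x = 0%R \/ exists2 f, List.In f (Fh j) & sim f x.
  elim: j x => [|j IH] x; first by move/L0b; right.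
  rewrite /= mem_cat => /orP [/IH [->|[f ff hf]]|]; first by left.
    by right; exists f => //; apply/In_derive; left.
  case/flatten_mapP => r rr /flatten_mapP [y yL /mapP [z zL ->]].
  have [->|[f ff hf]] := IH y yL.
    left; apply/ffunP => i; rewrite !ffunE mulmx0; by case: ifP.
  have [->|[g gf hg]] := IH z zL.
    left; apply/ffunP => i; rewrite !ffunE mul0mx; by case: ifP.
  have := Bsim r f g y z (labF _ _ ff) (labF _ _ gf) hf hg.
  case: ifP => [/andP [/eqP e1 /eqP e2] hs|_ ->]; last by left.
  right; exists (rule_res r, seq_subst f.2 g.2) => //.
  by apply/In_derive; right; exists r, f, g.
have AT : A \in Ts by rewrite mem_cat !inE eqxx orbT.
have BT : B \in Ts by rewrite mem_cat !inE eqxx !orbT.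
have [vA [a ha] _] := linear_value_subst hL hK (cov A AT).
have [vB [b hb] _] := linear_value_subst hL hK (cov B BT).
(* The difference of the numbers of both sides in the state reached from [s0], read off the
   component of label [rho]. *)
pose ob (x : V) : 'M[rat]_1 := ((a - b) *m (x (ix rho) *m state_vec n Ls K s0))%R.
have obl : linear ob.
  move=> e u v; rewrite /ob !ffunE.
  rewrite [((_ + _) *m state_vec _ _ _ _)%R]mulmxDl mulmxDr; congr (_ + _)%R.
  by rewrite -scalemxAl -scalemxAr.
have obE r (x : V) : sim (rho, r) x -> value_state Ls K (apply_subst r s0) /\
    (ob x 0 0 = (num n Ls K (subst (apply_subst r s0) A))%:R -
                (num n Ls K (subst (apply_subst r s0) B))%:R)%R.
  case=> M hM ->; have [v1 E1] := hM s0 vs0; split=> //.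
  by rewrite /ob ffunE eqxx E1 mulmxBl ha // hb // !mxE.
(* The [c.+1] labels account for the first factor of [height_bound], and the square of [d],
   estimated by [size_small], for the second. *)
have dimV : (\dim {: V} <= height_bound n)%N.
  rewrite dim_ffun_matrix /height_bound leq_mul //.
    by rewrite addn1 ltnS leq_add.
  rewrite mulnn leq_exp2r // /d card_option card_prod card_option !card_ord.
  rewrite add1n ltnS leq_mul // addn1 ltnS.
  apply: leq_trans (size_small n Ls K) _; rewrite leq_mul //.
  by rewrite addn1; case: (n ^ 2) => [|e]; rewrite ?expn0 // leq_exp2r.
have ob0 x : x \in Lh (height_bound n) -> ob x \in 0%VS.
  move=> xL; rewrite memv0; apply/eqP; case: (simL _ _ xL) => [->|[[l r] ff hf]].
    by rewrite /ob ffunE mul0mx mulmx0.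
  case: (eqVneq l rho) => [E|ne].
    rewrite E in ff hf; have [v1 E1] := obE r x hf.
    apply/matrixP => i j; rewrite !ord1 E1 mxE.
    by have := hyp r ff; rewrite /holds /= => ->; rewrite subrr.
  case: hf => M _ ->; rewrite /ob ffunE eq_sym ixP /=; last exact: labF ff.
  by rewrite (negPf ne) mul0mx mulmx0.
have [x xL hx] := simF h _ hr0; have [v1 E1] := obE r0 x hx.
have xH : x \in <<Lh (height_bound n)>>%VS.
  by apply: (subvP (span_saturation rules Bll Blr L0 h dimV)); exact: memv_span.
have := span_linear_sub obl ob0 xH; rewrite memv0 => /eqP obx.
move: E1; rewrite obx mxE => /esym/eqP; rewrite subr_eq0 eqr_nat => /eqP.
by apply: num_inj; [exact: hL|exact: hK|exact: vA|exact: vB].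
Qed.

End Facts.

(** * Facts and executions *)

(* [lab_same u]: same-level runs from the start of the procedure of [u] to [u];
   [lab_edge u v]: one edge, or one complete call, from [u] to [v];
   [lab_reach u]: runs of the program that reach [u], with any stack;
   [lab_init]: sequences of updates of the initial state. *)
Definition lab_same (u : tree) : tree := Node (code_nat 0) u.
Definition lab_reach (u : tree) : tree := Node (code_nat 1) u.
Definition lab_edge (u v : tree) : tree := Node (code_nat 2) (Node u v).
(** The label of the identity alone: the second premise of rules that really have only one. *)
Definition lab_id : tree := Node (code_nat 3) Leaf.
Definition lab_init : tree := Node (code_nat 4) Leaf.
Definition lab_havoc : tree := Node (code_nat 5) Leaf.

Lemma lab_same_inj : injective lab_same. Proof. by move=> u v []. Qed.

Lemma lab_reach_inj : injective lab_reach. Proof. by move=> u v []. Qed.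

Lemma lab_edge_inj u v u' v' :
  lab_edge u v = lab_edge u' v' -> u = u' /\ v = v'.
Proof. by case. Qed.

Definition single (Om : signature) k (x : 'I_k) (t : term Om 'I_k) :
    'I_k -> term Om 'I_k :=
  fun y => if y == x then t else Var y.

Lemma apply_single (Om : signature) k (x : 'I_k) t (s : state Om k) :
  apply_subst (single x t) s = update s x (subst s t).
Proof. by apply/ffunP => y; rewrite !ffunE /single; case: ifP. Qed.

Lemma apply_Var (Om : signature) k (s : state Om k) :
  apply_subst (fun x => Var x) s = s.
Proof. by apply/ffunP => y; rewrite ffunE. Qed.

Lemma holds_apply (Om : signature) k r (s : state Om k) A B :
  holds (apply_subst r s) (A, B) <-> holds s (subst r A, subst r B).
Proof.
rewrite /holds /= !subst_comp.
have E t : subst (apply_subst r s) t = subst (fun x => subst s (r x)) t.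
  by apply: eq_subst => x; rewrite ffunE.
by rewrite !E.
Qed.

(** With all variables but [x] fixed, both sides are contexts in the value of [x], and two arguments
    determine a context. *)
Lemma holds_two_values (Om : signature) k (s : state Om k) x (g1 g2 v : ground Om)
    (e : equality Om k) : g1 <> g2 ->
  holds (update s x g1) e -> holds (update s x g2) e -> holds (update s x v) e.
Proof.
move=> ne; pose p t := subst (fun y => if y == x then Var tt else of_ground unit (s y)) t.
have E w t : subst (update s x w) t = plug (p t) w.
  rewrite /plug /p subst_comp; apply: eq_subst => y; rewrite ffunE.
  by case: eqP => // _; rewrite subst_of_ground_ground.
rewrite /holds !E => h1 h2.
by rewrite (plug_two_points ne h1 h2).
Qed.

(** * The grammar of a program, its soundness and its completeness *)

Section Semantics.
Variables (Om : signature) (P : program Om) (g1 g2 : ground Om).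
Hypothesis g12 : g1 <> g2.
Local Notation k := (nvars P).
Local Notation tm := (term Om 'I_k).
Local Notation pt a := (code_point (at_point a)).
Local Notation lab := (label Om k (nprocs P)).

Lemma code_point_inj : injective (@code_point Om P).
Proof.
move=> [q a] [r b] [/code_nat_inj/val_inj E]; case: r / E b => b.
by move/code_nat_inj/val_inj => ->.
Qed.

(** [rule_return] condenses a complete run of the callee into an edge of the caller, while
    [rule_call] leaves the call pending; so calls and returns match although facts carry no
    stack. *)
Inductive program_rule : tree -> tree -> tree -> Prop :=
| rule_same q a l b : List.In (a, l, b) (edges (@proc Om P q)) ->
    program_rule (lab_same (pt a)) (lab_edge (pt a) (pt b)) (lab_same (pt b))
| rule_reach q a l b : List.In (a, l, b) (edges (@proc Om P q)) ->
    program_rule (lab_reach (pt a)) (lab_edge (pt a) (pt b)) (lab_reach (pt b))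
| rule_return q a r b : List.In (a, Call r, b) (edges (@proc Om P q)) ->
    program_rule (lab_same (pt (return_ (proc r)))) lab_id (lab_edge (pt a) (pt b))
| rule_call q a r b : List.In (a, Call r, b) (edges (@proc Om P q)) ->
    program_rule (lab_reach (pt a)) lab_id (lab_reach (pt (start (proc r))))
| rule_init : program_rule lab_init lab_havoc lab_init
| rule_main : program_rule lab_init lab_id (lab_reach (pt (start (proc (main P))))).

(** A call edge has no fact of its own: [rule_return] supplies its effects. *)
Definition edge_facts (q : 'I_(nprocs P))
    (d : 'I_(npoints (proc q)) * lab * 'I_(npoints (proc q))) : seq (fact Om k) :=
  let: (a, l, b) := d in
  let L := lab_edge (pt a) (pt b) in
  match l with
  | Assign x t => [:: (L, single x t)]
  | Havoc x => [:: (L, single x (of_ground _ g1)); (L, single x (of_ground _ g2))]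
  | Call _ => [::]
  end.

Definition program_facts : seq (fact Om k) :=
  flatten [seq flatten [seq edge_facts d | d <- edges (proc q)]
          | q <- enum 'I_(nprocs P)] ++
  flatten [seq [:: (lab_havoc, single x (of_ground _ g1)); (lab_havoc, single x (of_ground _ g2))]
          | x <- enum 'I_k] ++
  [seq (lab_same (pt (start (proc q))), fun x => Var x) | q <- enum 'I_(nprocs P)] ++
  [:: (lab_id, fun x => Var x); (lab_init, fun x => Var x)].

Variable rules : seq tree.
Hypothesis rulesP : forall r,
  r \in rules <-> exists A B C, r = rule A B C /\ program_rule A B C.

Local Notation facts h := (iter h (derive rules) program_facts).

Lemma In_enum n (i : 'I_n) : List.In i (enum 'I_n).
Proof. by apply/In_mem; rewrite mem_enum. Qed.

(** The reflexive transitive closure of [step] in impredicative form; it can be instantiated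
    directly with [reaches]. *)
Definition steps (c d : config P) : Prop :=
  forall Q : config P -> Prop,
    (forall c d, Q c -> step c d -> Q d) -> Q c -> Q d.

Lemma steps_trans c d e : steps c d -> steps d e -> steps c e.
Proof. by move=> h1 h2 Q hQ qc; exact: (h2 Q hQ (h1 Q hQ qc)). Qed.

Lemma steps_step c d : step c d -> steps c d.
Proof. by move=> h Q hQ qc; apply: hQ qc h. Qed.

(** Only the clause that matches the shape of [A] says something. Nothing is required of [lab_init]
    and [lab_havoc], since every state is initial. *)
Record meaning (A : tree) (r : 'I_k -> tm) : Prop := Meaning {
  mean_same : forall u : point P, A = lab_same (code_point u) -> forall st s,
    steps (at_point (start (proc (projT1 u))), st, s) (u, st, apply_subst r s);
  mean_edge : forall u v : point P, A = lab_edge (code_point u) (code_point v) ->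
    forall st s, steps (u, st, s) (v, st, apply_subst r s);
  mean_reach : forall u : point P, A = lab_reach (code_point u) -> forall s,
    exists st, reaches (u, st, apply_subst r s);
  mean_id : A = lab_id -> forall s, apply_subst r s = s }.

(** Induction on the height, with one case per rule. Same-level runs are claimed for every stack, so
    that they can be inserted below pending calls. *)
Lemma facts_sound h f : List.In f (facts h) -> meaning f.1 f.2.
Proof.
elim: h f => [|h IH] f.
  case/List.in_app_iff => [/In_flatmap [q _ /In_flatmap [[[a l] b] dd]]|].
    have edge r :
       (forall st s, step (at_point a, st, s) (@at_point Om P q b, st, apply_subst r s)) ->
       meaning (lab_edge (pt a) (pt b)) r.
      move=> hs; split=> //= u v /lab_edge_inj [/code_point_inj <- /code_point_inj <-] st s.
      by apply: steps_step; exact: hs.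
    case: l dd => [x t|x|r] dd /=.
    - move=> [<-|//]; apply: edge => st s; rewrite apply_single; exact: step_assign.
    - move=> [<-|[<-|//]]; apply: edge => st s;
        rewrite apply_single subst_of_ground_ground; exact: step_havoc.
    - by [].
  case/List.in_app_iff => [/In_flatmap [x _ /= [<-|[<-|//]]]|]; [by split..|].
  case/List.in_app_iff => [/In_map [q _ ->]|].
    by split=> //= u /lab_same_inj/code_point_inj <- st s; rewrite apply_Var.
  move=> /= [<-|[<-|//]]; split=> //= _ s; exact: apply_Var.
case/In_derive => [/IH //|[r [g [e [rr gf ef [e1 e2] ->]]]]].
have {IH} := IH; move=> IHh; have [gs ge gr gi] := IHh g gf; have [es ee er ei] := IHh e ef.
have [A [B [C [rE hr]]]] : exists A B C, r = rule A B C /\ program_rule A B C.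
  exact/rulesP.
rewrite rE /rule_fst /rule_snd /rule_res /= in e1 e2 *.
case: hr e1 e2 => [q a l b d|q a l b d|q a x b d|q a x b d||] e1 e2; split=> //=.
- move=> u /lab_same_inj/code_point_inj <- st s; rewrite apply_seq_subst.
  apply: steps_trans (ee _ _ (esym e2) st _); exact: (gs (at_point a)).
- move=> u /lab_reach_inj/code_point_inj <- s; rewrite apply_seq_subst.
  have [st hst] := gr _ (esym e1) s; exists st.
  by apply: (ee _ _ (esym e2) st) hst => c c'; exact: reaches_step.
- move=> u v /lab_edge_inj [/code_point_inj <- /code_point_inj <-] st s.
  rewrite apply_seq_subst (ei (esym e2)).
  apply: steps_trans (steps_step (step_call st s d)) _.
  apply: steps_trans (gs _ (esym e1) _ s) _.
  by apply: steps_step; exact: step_return.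
- move=> u /lab_reach_inj/code_point_inj <- s; rewrite apply_seq_subst (ei (esym e2)).
  have [st hst] := gr _ (esym e1) s; exists (at_point b :: st).
  exact: reaches_step hst (step_call st _ d).
- move=> u /lab_reach_inj/code_point_inj <- s; exists [::]; exact: reaches_init.
Qed.

Lemma facts_mono h h' f : h <= h' -> List.In f (facts h) -> List.In f (facts h').
Proof.
move=> /subnKC <-; rewrite addnC; elim: (h' - h) => // i IH hf.
by apply/In_derive; left; exact: IH.
Qed.

(** The language of the grammar with nondeterministic assignments left open; facts fix each of them
    to [g1] or [g2]. *)
Inductive run_word : tree -> seq lab -> Prop :=
| run_assign q a x t b : List.In (a, Assign x t, b) (edges (@proc Om P q)) ->
    run_word (lab_edge (pt a) (pt b)) [:: Assign x t]
| run_edge_havoc q a x b : List.In (a, Havoc x, b) (edges (@proc Om P q)) ->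
    run_word (lab_edge (pt a) (pt b)) [:: Havoc x]
| run_havoc x : run_word lab_havoc [:: Havoc x]
| run_start q : run_word (lab_same (pt (start (@proc Om P q)))) [::]
| run_id : run_word lab_id [::]
| run_init : run_word lab_init [::]
| run_rule A B C w1 w2 : program_rule A B C ->
    run_word A w1 -> run_word B w2 -> run_word C (w1 ++ w2).

Definition resolve (l : lab) (a : 'I_k * tm) : Prop :=
  match l with
  | Assign x t => a = (x, t)
  | Havoc x => a = (x, of_ground _ g1) \/ a = (x, of_ground _ g2)
  | Call _ => False
  end.

Inductive resolves : seq lab -> seq ('I_k * tm) -> Prop :=
| resolves_nil : resolves [::] [::]
| resolves_rcons w rs l a :
    resolves w rs -> resolve l a -> resolves (rcons w l) (rcons rs a).

Lemma resolves_nil_inv rs : resolves [::] rs -> rs = [::].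
Proof.
by move=> h; case E : _ _ / h => [|w rs' l a _ _] //; case: w E.
Qed.

Lemma resolves_rcons_inv w l rs : resolves (rcons w l) rs ->
  exists rs' a, [/\ rs = rcons rs' a, resolves w rs' & resolve l a].
Proof.
move=> h; case E : _ _ / h => [|w' rs' l' a h1 h2]; first by case: (w) E.
by have [-> ->] := rcons_inj E; exists rs', a.
Qed.

Definition assign_all (rs : seq ('I_k * tm)) (s : state Om k) : state Om k :=
  foldl (fun s a => update s a.1 (subst s a.2)) s rs.

Lemma assign_rcons rs a s :
  assign_all (rcons rs a) s = apply_subst (single a.1 a.2) (assign_all rs s).
Proof. by rewrite /assign_all foldl_rcons apply_single. Qed.

Lemma resolves_cat w1 w2 rs : resolves (w1 ++ w2) rs ->
  exists rs1 rs2, [/\ resolves w1 rs1, resolves w2 rs2 & rs = rs1 ++ rs2].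
Proof.
elim/last_ind: w2 rs => [|w2 l IH] rs.
  by rewrite cats0 => h; exists rs, [::]; rewrite cats0; split=> //; exact: resolves_nil.
rewrite -rcons_cat => /resolves_rcons_inv [rs' [a [-> /IH [r1 [r2 [h1 h2 ->]]] ha]]].
by exists r1, (rcons r2 a); rewrite rcons_cat; split=> //; exact: resolves_rcons.
Qed.

(** A resolution of a concatenation splits into resolutions of the parts; a rule then costs one
    round more than the later of its premises. *)
Lemma facts_complete A w : run_word A w -> forall rs, resolves w rs ->
  exists h r, List.In (A, r) (facts h) /\ forall s, apply_subst r s = assign_all rs s.
Proof.
have one l rs : resolves [:: l] rs -> exists a, rs = [:: a] /\ resolve l a.
  case/(@resolves_rcons_inv [::]) => rs' [a [-> /resolves_nil_inv -> ha]].
  by exists a.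
have edgeF q a l b f : List.In (a, l, b) (edges (@proc Om P q)) ->
    List.In f (edge_facts (a, l, b)) -> List.In f (facts 0).
  move=> dd hf; apply/List.in_app_iff; left; apply/In_flatmap; exists q; first exact: In_enum.
  by apply/In_flatmap; exists (a, l, b).
elim=> {A w} [q a x t b d|q a x b d|x|q|||A B C w1 w2 hr _ IH1 _ IH2] rs.
- case/one => _ [-> ->]; exists 0, (single x t); split; last by move=> s; exact: apply_single.
  by apply: edgeF d _; left.
- case/one => c [-> [->|->]]; exists 0; eexists;
    (split; last by move=> s; exact: apply_single); apply: edgeF d _ => /=; auto.
- case/one => c [-> [->|->]]; exists 0; eexists;
    (split; last by move=> s; exact: apply_single); apply/List.in_app_iff; right;
    apply/List.in_app_iff; left; apply/In_flatmap; exists x; rewrite /=; auto; exact: In_enum.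
- move/resolves_nil_inv->; exists 0, (fun x => Var x); split; last by move=> s; exact: apply_Var.
  apply/List.in_app_iff; right; apply/List.in_app_iff; right; apply/List.in_app_iff; left.
  by apply/In_map; exists q => //; exact: In_enum.
- move/resolves_nil_inv->; exists 0, (fun x => Var x); split; last by move=> s; exact: apply_Var.
  by do 3 (apply/List.in_app_iff; right); left.
- move/resolves_nil_inv->; exists 0, (fun x => Var x); split; last by move=> s; exact: apply_Var.
  by do 3 (apply/List.in_app_iff; right); right; left.
case/resolves_cat => rs1 [rs2 [h1 h2 ->]].
have [i [r [ri ei]]] := IH1 _ h1; have [j [q [qj ej]]] := IH2 _ h2.
exists (maxn i j).+1, (seq_subst r q); split; last first.
  by move=> s; rewrite apply_seq_subst ei ej /assign_all foldl_cat.
apply/In_derive; right; exists (rule A B C), (A, r), (B, q); split=> //.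
- by apply/rulesP; exists A, B, C.
- by apply: facts_mono ri; exact: leq_maxl.
- by apply: facts_mono qj; exact: leq_maxr.
Qed.

Inductive exec_word (s : state Om k) : seq lab -> state Om k -> Prop :=
| exec_nil : exec_word s [::] s
| exec_assign w s' x t : exec_word s w s' ->
    exec_word s (rcons w (Assign x t)) (update s' x (subst s' t))
| exec_havoc w s' x v : exec_word s w s' ->
    exec_word s (rcons w (Havoc x)) (update s' x v).

(** Backwards from the last label, for all equalities at once: an assignment is undone by
    substituting into the equality, and for an arbitrary value [g1] and [g2] suffice by
    [holds_two_values]. *)
Lemma holds_exec s w s' : exec_word s w s' -> forall e,
  (forall rs, resolves w rs -> holds (assign_all rs s) e) -> holds s' e.
Proof.
elim=> {w s'} [|w s' x t _ IH|w s' x v _ IH] [A B] he.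
- exact: he resolves_nil.
- rewrite -apply_single; apply/holds_apply; apply: IH => rs hrs.
  apply/holds_apply; have := he _ (resolves_rcons hrs (erefl : resolve (Assign x t) _)).
  by rewrite assign_rcons.
- apply: (holds_two_values _ g12).
  + rewrite -(subst_of_ground_ground s' g1) -apply_single; apply/holds_apply; apply: IH => rs hrs.
    apply/holds_apply; have := he _ (resolves_rcons hrs (or_introl erefl : resolve (Havoc x) _)).
    by rewrite assign_rcons.
  + rewrite -(subst_of_ground_ground s' g2) -apply_single; apply/holds_apply; apply: IH => rs hrs.
    apply/holds_apply; have := he _ (resolves_rcons hrs (or_intror erefl : resolve (Havoc x) _)).
    by rewrite assign_rcons.
Qed.

(* [stacked u st w]: [w] leads to [u] with the stack [st] of pending calls. *)
Inductive stacked : point P -> seq (point P) -> seq lab -> Prop :=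
| stacked_main u w0 w : projT1 u = main P -> run_word lab_init w0 ->
    run_word (lab_same (code_point u)) w -> stacked u [::] (w0 ++ w)
| stacked_call q a b u st w1 w2 : stacked (@at_point Om P q a) st w1 ->
    List.In (a, Call (projT1 u), b) (edges (proc q)) ->
    run_word (lab_same (code_point u)) w2 ->
    stacked u (at_point b :: st) (w1 ++ w2).

Lemma stacked_edge q a l b st w w' : stacked (@at_point Om P q a) st w ->
  List.In (a, l, b) (edges (proc q)) ->
  run_word (lab_edge (pt a) (pt b)) w' -> stacked (at_point b) st (w ++ w').
Proof.
move=> h d hw'; case E : _ _ _ / h => [u w0 w1 um h0 h1|q' a' b' u st' w1 w2 h1 d' h2].
  rewrite -catA; apply: stacked_main => //; first by rewrite -um -E.
  by apply: run_rule (rule_same d) _ hw'; rewrite E.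
rewrite -catA; rewrite -E in d' h2.
apply: (@stacked_call q' a' b' (at_point b) _ _ _ h1 d').
exact: run_rule (rule_same d) h2 hw'.
Qed.

(** A same-level run is replayed edge by edge from a reached start point, and each pending call is
    entered by [rule_call]. *)
Lemma stacked_reach u st w : stacked u st w -> run_word (lab_reach (code_point u)) w.
Proof.
have key A w2 : run_word A w2 -> forall (u : point P) w1, A = lab_same (code_point u) ->
    run_word (lab_reach (pt (start (proc (projT1 u))))) w1 ->
    run_word (lab_reach (code_point u)) (w1 ++ w2).
  elim=> {A w2} [q a x t b _|q a x b _|x|q|||A B C w1 w2] //.
    by move=> u' w1 /lab_same_inj/code_point_inj <-; rewrite cats0.
  case=> // q a l b d h1 IH h2 _ u' w0 /lab_same_inj/code_point_inj <- h0.
  rewrite catA; apply: run_rule (rule_reach d) _ h2.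
  exact: (IH (at_point a)).
elim=> {u st w} [u w0 w um h0 h1|q a b u st w1 w2 _ h1 d h2].
  apply: key h1 _ _ (erefl _) _; rewrite um -[w0]cats0.
  exact: run_rule rule_main h0 run_id.
apply: key h2 _ _ (erefl _) _; rewrite -[w1]cats0.
exact: run_rule (rule_call d) h1 run_id.
Qed.

(** Any initial state arises from [s0] by arbitrary assignments, so a single initial state
    suffices. *)
Lemma exec_init (s0 s : state Om k) :
  exists2 w, run_word lab_init w & exec_word s0 w s.
Proof.
have [w hw [s' hs e]] : exists2 w, run_word lab_init w &
    exists2 s', exec_word s0 w s' & forall x, x \in enum 'I_k -> s' x = s x.
  elim: (enum 'I_k) => [|x xs [w hw [s' hs e]]].
    by exists [::]; [exact: run_init|exists s0 => //; exact: exec_nil].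
  exists (rcons w (Havoc x)); last first.
    exists (update s' x (s x)); first exact: exec_havoc.
    move=> y; rewrite in_cons ffunE; case: eqP => [-> //|_] /=; exact: e.
  rewrite -cats1; exact: run_rule rule_init hw (run_havoc x).
exists w => //; have <- // : s' = s by apply/ffunP => x; apply: e; rewrite mem_enum.
Qed.

Lemma reaches_word (s0 : state Om k) c : reaches c ->
  exists2 w, stacked c.1.1 c.1.2 w & exec_word s0 w c.2.
Proof.
elim=> {c} [s|c d _ [w hw hs] hcd] /=.
  have [w hw hs] := exec_init s0 s; exists w => //.
  by rewrite -[w]cats0; apply: stacked_main => //; exact: run_start.
case: hcd hw hs => {c d} [q a x t b st s d|q a x b st s v d|q a r b st s d|q u st s] /= hw hs.
- exists (w ++ [:: Assign x t]); last by rewrite cats1; exact: exec_assign.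
  exact: (stacked_edge hw d (run_assign d)).
- exists (w ++ [:: Havoc x]); last by rewrite cats1; exact: exec_havoc.
  exact: (stacked_edge hw d (run_edge_havoc d)).
- exists w => //; rewrite -[w]cats0; 
  apply: (@stacked_call q a b (at_point (start (proc r))) _ _ _ hw d).
  exact: run_start.
(* On return, the last same-level run is a complete run of the callee; [rule_return] makes it an
   edge that extends the run of the caller. *)
- exists w => //; case E1 : _ {-1}(u :: st) _ / hw (erefl (u :: st)) hs =>
    [u' w0 w1 um h0 h1|q' a' b' u' st' w1 w2 h1 d' h2] //.
  case=> -> -> _; rewrite -E1 /= in d' h2.
  rewrite -[w2]cats0; apply: (stacked_edge h1 d').
  exact: (run_rule (rule_return d') h2 run_id).
Qed.

Theorem valid_facts (s0 : state Om k) (u : point P) (e : equality Om k) :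
  valid_at u e <-> forall h r,
    List.In (lab_reach (code_point u), r) (facts h) -> holds (apply_subst r s0) e.
Proof.
split=> [v h r hr|hf st s hu].
  have [st hst] := mean_reach (facts_sound hr) (erefl _) s0; exact: v hst.
have [w hw hs] := reaches_word s0 hu; apply: (holds_exec hs) => rs hrs.
have [h [r [hr er]]] := facts_complete (stacked_reach hw) hrs.
by rewrite -er; exact: hf hr.
Qed.

Lemma program_facts_unary : unary_assignments P ->
  forall f x, List.In f program_facts -> #|vars (f.2 x)| <= 1.
Proof.
move=> uP f x.
have hs y t : #|vars t| <= 1 -> #|vars (single y t x)| <= 1.
  by rewrite /single; case: ifP => //= _ _; rewrite cards1.
have hl (g : ground Om) : #|vars (of_ground 'I_k g)| <= 1 by rewrite vars_of_ground cards0.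
case/List.in_app_iff => [/In_flatmap [q _ /In_flatmap [[[a l] b] dd]]|].
  case: l dd => [y t|y|r] dd //= [<-|]; rewrite ?hs //=; first exact: uP dd.
  by case=> [<-|//]; rewrite hs.
case/List.in_app_iff => [/In_flatmap [y _ /= [<-|[<-|//]]]|]; rewrite ?hs //.
case/List.in_app_iff => [/In_map [q _ ->]|]; first by rewrite /= cards1.
by move=> /= [<-|[<-|//]]; rewrite /= cards1.
Qed.

End Semantics.

(** * The algorithms *)

Ltac computability lem := repeat (cbv beta; first
  [ exact: computable_const | exact: computable_id | assumption | lem
  | apply: computable_lchild | apply: computable_rchild
  | apply: computable_node | apply: computable_tif
  | apply: lcomputable_cat | apply: lcomputable_map | apply: lcomputable_flatmap
  | apply: lcomputable_filter | apply: lcomputable_if | apply: lcomputable_cons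
  | apply: lcomputable_tlist | apply: bcomputable_and | apply: computable_eq
  | apply: bcomputable_all | apply: computable_if | apply: computable_trec
  | match goal with H : computable _ |- _ => apply: (computable_comp H) end ]).

Definition tree_nth (l n : tree) : tree :=
  lchild (trec l (fun _ _ _ r => rchild r) n).

Lemma computable_nth f g :
  computable f -> computable g -> computable (fun x => tree_nth (f x) (g x)).
Proof. by move=> hf hg; rewrite /tree_nth; computability fail. Qed.

Lemma tree_nthE s i : tree_nth (code_seq s) (code_nat i) = nth Leaf s i.
Proof.
have E : trec (code_seq s) (fun _ _ _ r => rchild r) (code_nat i) = code_seq (drop i s).
  elim: i => [|i IH] /=; first by rewrite drop0.
  by rewrite IH -add1n -drop_drop drop1; case: (drop i s).
rewrite /tree_nth E; case: (ltnP i (size s)) => h.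
  by rewrite (drop_nth Leaf).
by rewrite drop_oversize // nth_default.
Qed.

Definition tree_range (n : tree) : seq tree :=
  tlist (trec Leaf (fun _ b _ r => code_seq (tlist r ++ [:: b])) n).

Lemma computable_range f :
  computable f -> lcomputable (fun x => tree_range (f x)).
Proof. by move=> hf; rewrite /tree_range; computability fail. Qed.

Lemma tree_rangeE n : tree_range (code_nat n) = [seq code_nat i | i : 'I_n <- enum 'I_n].
Proof.
have -> : [seq code_nat i | i : 'I_n <- enum 'I_n] = [seq code_nat i | i <- iota 0 n].
  by rewrite -val_enum_ord -map_comp.
rewrite /tree_range; elim: n => // n IH.
by rewrite -[in RHS]addn1 iotaD map_cat -IH /= code_seqK.
Qed.

(* A tree can be read as the code of a term and as the code of a list of terms;
   the recursion returns the results for both readings. *)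
Definition tree_subst (l : seq tree) (t : tree) : tree :=
  lchild (trec (Node Leaf Leaf) (fun a b ra rb =>
    Node (tif a (Node a (Node (lchild b) (rchild (rchild rb)))) (tree_nth (code_seq l) b))
         (Node (lchild ra) (rchild rb))) t).

Lemma computable_subst L f :
  lcomputable L -> computable f -> computable (fun x => tree_subst (L x) (f x)).
Proof.
move=> hL hf; rewrite /tree_subst; computability ltac:(apply: computable_nth).
Qed.

(** Substitutions are represented by the list of the codes of their values, in the order of the
    variables. *)
Definition tree_comp (r q : seq tree) : seq tree := [seq tree_subst r t | t <- q].

Lemma computable_tree_comp L M : lcomputable L -> lcomputable M ->
  lcomputable (fun x => tree_comp (L x) (M x)).
Proof.
move=> hL hM; rewrite /tree_comp; computability ltac:(apply: computable_subst).
Qed.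

Definition tree_derive (rules fs : seq tree) : seq tree :=
  fs ++ flatten [seq flatten [seq flatten [seq
    (if (rule_fst r == lchild f) && (rule_snd r == lchild g)
     then [:: Node (rule_res r)
                (code_seq (tree_comp (tlist (rchild f)) (tlist (rchild g))))]
     else [::])
    | g <- fs] | f <- fs] | r <- rules].

Lemma computable_tree_derive L M : lcomputable L -> lcomputable M ->
  lcomputable (fun x => tree_derive (L x) (M x)).
Proof.
move=> hL hM; rewrite /tree_derive /rule_fst /rule_snd /rule_res.
computability ltac:(apply: computable_tree_comp).
Qed.

Lemma ncomputable_height_bound N :
  ncomputable N -> ncomputable (fun x => height_bound (N x)).
Proof.
move=> hN; have hc m : ncomputable (fun _ => m) by exact: computable_const.
rewrite /height_bound; repeat first [exact: hN | exact: hc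
  | apply: ncomputable_add | apply: ncomputable_mul | apply: ncomputable_exp].
Qed.

(** * Reading a coded program and compiling it to rules and facts *)

Definition prog_vars (p : tree) : tree := lchild p.
Definition prog_procs (p : tree) : seq tree := tree_range (lchild (rchild p)).
Definition prog_cfg (p q : tree) : tree := tree_nth (lchild (rchild (rchild p))) q.
Definition prog_main (p : tree) : tree := rchild (rchild (rchild p)).
Definition prog_start (p q : tree) : tree :=
  Node q (lchild (rchild (prog_cfg p q))).
Definition prog_return (p q : tree) : tree :=
  Node q (lchild (rchild (rchild (prog_cfg p q)))).
Definition prog_edges (p q : tree) : seq tree :=
  tlist (rchild (rchild (rchild (prog_cfg p q)))).

Definition tree_edge_rules (p q d : tree) : seq tree :=
  let u := Node q (lchild d) in
  let l := lchild (rchild d) in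
  let v := Node q (rchild (rchild d)) in
  [:: rule (lab_same u) (lab_edge u v) (lab_same v);
      rule (lab_reach u) (lab_edge u v) (lab_reach v)] ++
  (if lchild l == code_nat 2
   then [:: rule (lab_same (prog_return p (rchild l))) lab_id (lab_edge u v);
            rule (lab_reach u) lab_id (lab_reach (prog_start p (rchild l)))]
   else [::]).

Definition tree_rules (p : tree) : seq tree :=
  flatten [seq flatten [seq tree_edge_rules p q d | d <- prog_edges p q]
          | q <- prog_procs p] ++
  [:: rule lab_init lab_havoc lab_init;
      rule lab_init lab_id (lab_reach (prog_start p (prog_main p)))].

Lemma computable_tree_rules f :
  computable f -> lcomputable (fun x => tree_rules (f x)).
Proof.
move=> hf; rewrite /tree_rules /tree_edge_rules /prog_edges /prog_start
  /prog_return /prog_cfg /prog_procs /prog_main /rule /lab_same /lab_reach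
  /lab_edge /=.
computability ltac:(first [apply: computable_nth | apply: computable_range]).
Qed.

Definition tree_single (n x t : tree) : seq tree :=
  [seq (if y == x then t else Node Leaf y) | y <- tree_range n].

Lemma computable_tree_single f g h : computable f -> computable g -> computable h ->
  lcomputable (fun x => tree_single (f x) (g x) (h x)).
Proof.
move=> hf hg hh; rewrite /tree_single.
computability ltac:(apply: computable_range).
Qed.

Definition tree_identity (n : tree) : seq tree := [seq Node Leaf y | y <- tree_range n].

Lemma computable_tree_identity f :
  computable f -> lcomputable (fun x => tree_identity (f x)).
Proof.
move=> hf; rewrite /tree_identity; computability ltac:(apply: computable_range).
Qed.

Section Algorithm.
Variables c1 c2 : tree.

(** [c1] and [c2] stand for the codes of [g1] and [g2]; they are built into the algorithm, which
    does not search for them. *)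
Definition tree_edge_facts (n q d : tree) : seq tree :=
  let L := lab_edge (Node q (lchild d)) (Node q (rchild (rchild d))) in
  let l := lchild (rchild d) in
  if lchild l == code_nat 0
  then [:: Node L (code_seq (tree_single n (lchild (rchild l)) (rchild (rchild l))))]
  else if lchild l == code_nat 1
  then [:: Node L (code_seq (tree_single n (rchild l) c1));
           Node L (code_seq (tree_single n (rchild l) c2))]
  else [::].

Definition tree_facts (p : tree) : seq tree :=
  flatten [seq flatten [seq tree_edge_facts (prog_vars p) q d | d <- prog_edges p q]
          | q <- prog_procs p] ++
  flatten [seq [:: Node lab_havoc (code_seq (tree_single (prog_vars p) x c1));
                   Node lab_havoc (code_seq (tree_single (prog_vars p) x c2))]
          | x <- tree_range (prog_vars p)] ++
  [seq Node (lab_same (prog_start p q)) (code_seq (tree_identity (prog_vars p)))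
  | q <- prog_procs p] ++
  [:: Node lab_id (code_seq (tree_identity (prog_vars p)));
      Node lab_init (code_seq (tree_identity (prog_vars p)))].

Lemma computable_tree_facts f :
  computable f -> lcomputable (fun x => tree_facts (f x)).
Proof.
move=> hf; rewrite /tree_facts /tree_edge_facts /prog_vars /prog_edges /prog_start
  /prog_cfg /prog_procs /lab_same /lab_edge /=.
computability ltac:(first [apply: computable_tree_single
  | apply: computable_tree_identity | apply: computable_nth | apply: computable_range]).
Qed.

Definition tree_init (p : tree) : seq tree := [seq c1 | _ <- tree_range (prog_vars p)].

(** The size of one tree with all the data dominates every quantity that [saturation] bounds by [n];
    [extra] accounts for the equalities to be tested. *)
Definition tree_bound (p extra : tree) : nat :=
  tree_size (Node (code_seq (tree_rules p)) (Node (code_seq (tree_facts p))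
    (Node (code_seq (tree_init p)) extra))).

Definition tree_saturated (p extra : tree) : seq tree :=
  tlist (iter (height_bound (tree_bound p extra))
    (fun t => code_seq (tree_derive (tree_rules p) (tlist t)))
    (code_seq (tree_facts p))).

Definition tree_states (p u extra : tree) : seq tree :=
  [seq code_seq (tree_comp (tree_init p) (tlist (rchild f)))
  | f <- [seq f <- tree_saturated p extra | lchild f == lab_reach u]].

Lemma computable_tree_states f g h : computable f -> computable g -> computable h ->
  lcomputable (fun x => tree_states (f x) (g x) (h x)).
Proof.
move=> hf hg hh.
have hi : lcomputable (fun x => tree_init (f x)).
  rewrite /tree_init /prog_vars; computability ltac:(apply: computable_range).
have hr := computable_tree_rules hf; have hF := computable_tree_facts hf.
have hb : ncomputable (fun x => tree_bound (f x) (h x)).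
  rewrite /tree_bound; apply: ncomputable_tree_size; computability fail.
have hs : lcomputable (fun x => tree_saturated (f x) (h x)).
  rewrite /tree_saturated; apply: lcomputable_tlist; apply: computable_iter => //; last first.
    computability ltac:(apply: computable_tree_derive).
  exact: ncomputable_height_bound hb.
rewrite /tree_states /lab_reach; computability ltac:(apply: computable_tree_comp).
Qed.

Definition tree_holds (s e : tree) : bool :=
  tree_subst (tlist s) (lchild e) == tree_subst (tlist s) (rchild e).

Definition tree_decide (p u e : tree) : bool :=
  all (fun s => tree_holds s e) (tree_states p u e).

Lemma computable_tree_decide :
  bcomputable (fun x => tree_decide (lchild x) (lchild (rchild x)) (rchild (rchild x))).
Proof.
rewrite /tree_decide /tree_holds.
apply: bcomputable_all; first apply: computable_tree_states.
all: computability ltac:(apply: computable_subst).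
Qed.

(* As in [tree_subst], there is one component for terms and one for lists of
   terms; the third one is the list component of the right child. *)
Definition tree_patterns (w v t : tree) : seq tree :=
  tlist (lchild (trec (Node Leaf (Node (code_seq [:: Leaf]) Leaf)) (fun a b ra rb =>
    Node (code_seq ((if Node a b == v then [:: w] else [::]) ++
            [seq Node a (Node (lchild b) q) | q <- tlist (rchild (rchild rb))]))
   (Node (code_seq (flatten [seq [seq Node p q | q <- tlist (lchild (rchild rb))]
                            | p <- tlist (lchild ra)]))
         (lchild (rchild rb)))) t)).

Lemma computable_tree_patterns f g h : computable f -> computable g -> computable h ->
  lcomputable (fun x => tree_patterns (f x) (g x) (h x)).
Proof. move=> hf hg hh; rewrite /tree_patterns; computability fail. Qed.

Definition tree_candidates (n s : tree) : seq tree :=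
  flatten [seq flatten [seq [seq Node (Node Leaf x) t
      | t <- tree_patterns (Node Leaf y) (tree_nth s y) (tree_nth s x)]
    | y <- tree_range n] | x <- tree_range n].

(* [ss] are states that witness the reachability of [u], if it is reachable. *)
Definition tree_infer_from (p u : tree) (ss : seq tree) : seq tree :=
  if code_seq ss == Leaf then [:: Node c1 c2]
  else let s := lchild (code_seq ss) in
    [seq e <- tree_candidates (prog_vars p) s
    | all (fun r => tree_holds r e) (tree_states p u s)].

Definition tree_infer (p u : tree) : seq tree :=
  tree_infer_from p u (tree_states p u (Node c1 c2)).

Lemma computable_tree_candidates f g : computable f -> computable g ->
  lcomputable (fun x => tree_candidates (f x) (g x)).
Proof.
move=> hf hg; rewrite /tree_candidates.
computability ltac:(first [apply: computable_tree_patterns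
  | apply: computable_nth | apply: computable_range]).
Qed.

Lemma computable_tree_infer :
  lcomputable (fun x => tree_infer (lchild x) (rchild x)).
Proof.
have hc : computable (fun=> Node c1 c2) by exact: computable_const.
have hl := computable_lchild computable_id; have hr := computable_rchild computable_id.
have hs := computable_tree_states hl hr hc.
rewrite /tree_infer /tree_infer_from; apply: lcomputable_if.
- exact: computable_eq hs (computable_const Leaf).
- exact: computable_const.
have h0 := computable_lchild hs.
apply: lcomputable_filter; first exact: computable_tree_candidates (computable_lchild hl) h0.
have hll := computable_comp hl hl; have hrl := computable_comp hr hl.
have h0l := computable_comp h0 hl.
apply: bcomputable_all; first exact: computable_tree_states hll hrl h0l.
rewrite /tree_holds; computability ltac:(apply: computable_subst).
Qed.

End Algorithm.

(** * Correctness of the codes *)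

Section Codes.
Variables (Om : signature) (k : nat).
Local Notation tm := (term Om 'I_k).

Definition code_subst (r : 'I_k -> tm) : seq tree :=
  [seq code_term (r x) | x <- enum 'I_k].

Definition code_fact (f : fact Om k) : tree := Node f.1 (code_seq (code_subst f.2)).

(** With a state as a substitution, [tree_comp] also computes the state that a fact leads to. *)
Definition ground_subst (s : state Om k) : 'I_k -> tm := fun x => of_ground _ (s x).

Definition code_state (s : state Om k) : tree := code_seq (code_subst (ground_subst s)).

Lemma nth_code_subst r (x : 'I_k) : nth Leaf (code_subst r) x = code_term (r x).
Proof. by rewrite (nth_map x) ?nth_ord_enum // size_enum_ord. Qed.

Lemma tree_substE r (t : tm) :
  tree_subst (code_subst r) (code_term t) = code_term (subst r t).
Proof.
pose R := trec (Node Leaf Leaf) (fun a b ra rb =>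
    Node (tif a (Node a (Node (lchild b) (rchild (rchild rb))))
            (tree_nth (code_seq (code_subst r)) b))
         (Node (lchild ra) (rchild rb))).
change (lchild (R (code_term t)) = code_term (subst r t)).
have RL s : rchild (R (code_seq s)) = code_seq [seq lchild (R c) | c <- s].
  by elim: s => //= c s IH; rewrite -IH.
elim/term_nested_ind: t => [x|f a IH] /=.
  by rewrite tree_nthE nth_code_subst.
congr (Node _ (Node _ _)).
rewrite -/(R _) RL -map_comp; congr code_seq; apply: eq_map => i /=.
by rewrite ffunE; exact: IH.
Qed.

Lemma tree_compE r q :
  tree_comp (code_subst r) (code_subst q) = code_subst (seq_subst r q).
Proof.
rewrite /tree_comp /code_subst -map_comp; apply: eq_map => x /=.
exact: tree_substE.
Qed.

Lemma tree_deriveE rules (fs : seq (fact Om k)) :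
  tree_derive rules [seq code_fact f | f <- fs] =
  [seq code_fact f | f <- derive rules fs].
Proof.
rewrite /tree_derive /derive map_cat map_flatten -map_comp; congr (_ ++ flatten _).
apply: eq_map => r /=; rewrite map_flatten -!map_comp; congr flatten.
apply: eq_map => f /=; rewrite map_flatten -!map_comp; congr flatten.
apply: eq_map => g /=; case: ifP => //= _.
by rewrite /code_fact /= !code_seqK tree_compE.
Qed.

Lemma tree_iterE rules n (fs : seq (fact Om k)) :
  tlist (iter n (fun t => code_seq (tree_derive rules (tlist t)))
    (code_seq [seq code_fact f | f <- fs])) =
  [seq code_fact f | f <- iter n (derive rules) fs].
Proof.
elim: n => [|n IH] /=; first by rewrite code_seqK.
by rewrite IH code_seqK tree_deriveE.
Qed.

Lemma tree_singleE (x : 'I_k) (t : tm) :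
  tree_single (code_nat k) (code_nat x) (code_term t) = code_subst (single x t).
Proof.
rewrite /tree_single tree_rangeE -map_comp; apply: eq_map => y /=.
by rewrite (inj_eq code_nat_inj) /single -val_eqE; case: ifP.
Qed.

Lemma tree_identityE :
  tree_identity (code_nat k) = code_subst (fun x => Var x).
Proof. by rewrite /tree_identity tree_rangeE -map_comp. Qed.

Lemma subst_ground_subst (s : state Om k) (t : tm) :
  subst (ground_subst s) t = of_ground _ (subst s t).
Proof. by rewrite /of_ground subst_comp. Qed.

Lemma seq_ground_subst (s : state Om k) r :
  seq_subst (ground_subst s) r =1 ground_subst (apply_subst r s).
Proof. by move=> x; rewrite /seq_subst subst_ground_subst /ground_subst ffunE. Qed.

Lemma tree_size_code_seq s : tree_size (code_seq s) = \sum_(t <- s) (tree_size t).+1.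
Proof. by elim: s => [|t s IH] /=; rewrite ?big_nil // big_cons IH addSn. Qed.

Lemma tree_size_code_term (t : tm) : term_size t <= tree_size (code_term t).
Proof.
elim/term_nested_ind: t => //= f a IH; rewrite ltnS add1n ltnW // ltnS ltnW // ltnS.
rewrite (leq_trans _ (leq_addl _ _)) // tree_size_code_seq big_map big_enum /=.
by apply: leq_sum => i _; rewrite (leq_trans (IH i)).
Qed.

Lemma tree_size_code_subst r :
  \sum_x (term_size (r x)).+1 <= tree_size (code_seq (code_subst r)).
Proof.
rewrite tree_size_code_seq big_map big_enum /=; apply: leq_sum => x _.
exact: tree_size_code_term.
Qed.

Lemma size_le_code_seq s : size s <= tree_size (code_seq s).
Proof. by elim: s => //= t s IH; rewrite ltnS (leq_trans IH) // leq_addl. Qed.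

Lemma of_ground_inj (g : ground Om) : injective (@of_ground Om 'I_k).
Proof.
by move=> a b E; rewrite -(subst_of_ground_ground (fun _ : 'I_k => g) a) E subst_of_ground_ground.
Qed.

Lemma tree_holdsP (g : ground Om) (s : state Om k) (e : equality Om k) :
  reflect (holds s e) (tree_holds (code_state s) (code_equality e)).
Proof.
rewrite /tree_holds /code_state code_seqK /= !tree_substE !subst_ground_subst.
apply: (iffP eqP) => [/code_term_inj/(of_ground_inj g)|->] //.
Qed.

End Codes.

Section Ground.
Variable Om : signature.

(** Independent of the number of variables, so the same constants serve all programs. *)
Definition code_ground (g : ground Om) : tree := code_with (fun v : void => match v with end) g.

Lemma code_of_ground k (g : ground Om) : code_term (of_ground 'I_k g) = code_ground g.
Proof.
elim/term_nested_ind: g => [[]|f a IH] /=.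
congr (Node _ (Node _ (code_seq _))); apply: eq_map => i.
by rewrite ffunE; exact: IH.
Qed.

End Ground.

Section Correctness.
Variables (Om : signature) (g1 g2 : ground Om).
Hypothesis g12 : g1 <> g2.
Local Notation c1 := (code_ground g1).
Local Notation c2 := (code_ground g2).

Section Compile.
Variable P : program Om.
Local Notation p := (code_program P).
Local Notation k := (nvars P).

Lemma prog_cfgE (q : 'I_(nprocs P)) : prog_cfg p (code_nat q) = code_cfg (proc q).
Proof. by rewrite /prog_cfg tree_nthE (nth_map q) ?nth_ord_enum // size_enum_ord. Qed.

Lemma prog_startE (q : 'I_(nprocs P)) :
  prog_start p (code_nat q) = code_point (at_point (start (proc q))).
Proof. by rewrite /prog_start prog_cfgE. Qed.

Lemma prog_returnE (q : 'I_(nprocs P)) :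
  prog_return p (code_nat q) = code_point (at_point (return_ (proc q))).
Proof. by rewrite /prog_return prog_cfgE. Qed.

Lemma prog_edgesE (q : 'I_(nprocs P)) :
  prog_edges p (code_nat q) = [seq code_edge d | d <- edges (proc q)].
Proof. by rewrite /prog_edges prog_cfgE code_seqK. Qed.

Lemma flatten_edges (F : tree -> tree -> seq tree) :
  flatten [seq flatten [seq F q d | d <- prog_edges p q] | q <- prog_procs p] =
  flatten [seq flatten [seq F (code_nat q) (code_edge d) | d <- edges (proc q)]
          | q : 'I_(nprocs P) <- enum 'I_(nprocs P)].
Proof.
rewrite /prog_procs tree_rangeE -map_comp; congr flatten; apply: eq_map => q /=.
by rewrite prog_edgesE -map_comp.
Qed.

Lemma tree_rulesP r :
  r \in tree_rules p <-> exists A B C, r = rule A B C /\ program_rule P A B C.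
Proof.
have step A B C : program_rule P A B C -> exists A' B' C',
    rule A B C = rule A' B' C' /\ program_rule P A' B' C'.
  by move=> h; exists A, B, C.
rewrite -In_mem /tree_rules List.in_app_iff flatten_edges; split.
  case=> [/In_flatmap [q _ /In_flatmap [[[a l] b] dd]]|].
    move=> /= [<-|[<-|]]; [exact: step (rule_same dd)|exact: step (rule_reach dd)|].
    case: l dd => [x t|x|c] dd //=.
    rewrite prog_returnE prog_startE.
    by move=> [<-|[<-|//]]; [exact: step (rule_return dd)|exact: step (rule_call dd)].
  move=> /= [<-|[<-|//]]; first exact: step (rule_init P).
  rewrite (_ : prog_main p = code_nat (main P)) // prog_startE; exact: step (rule_main P).
case=> A [B [C [-> h]]].
have edge q d (z : tree) : List.In d (edges (@proc Om P q)) ->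
    List.In z (tree_edge_rules p (code_nat q) (code_edge d)) ->
    List.In z (flatten [seq flatten [seq tree_edge_rules p (code_nat q) (code_edge d)
      | d <- edges (proc q)] | q : 'I_(nprocs P) <- enum 'I_(nprocs P)]).
  move=> dd hz; apply/In_flatmap; exists q; first exact: In_enum.
  by apply/In_flatmap; exists d.
case: h => [q a l b d|q a l b d|q a c b d|q a c b d||].
- by left; apply: edge d _; left.
- by left; apply: edge d _; right; left.
- left; apply: edge d _ => /=; rewrite prog_returnE; by right; right; left.
- left; apply: edge d _ => /=; rewrite prog_startE; by right; right; right; left.
- by right; left.
- right; right; left; by rewrite (_ : prog_main p = code_nat (main P)) // prog_startE.
Qed.

Lemma tree_factsE :
  tree_facts c1 c2 p = [seq code_fact f | f <- program_facts P g1 g2].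
Proof.
rewrite /tree_facts /program_facts flatten_edges !map_cat.
congr (_ ++ (_ ++ (_ ++ _))).
- rewrite map_flatten -map_comp; congr flatten; apply: eq_map => q /=.
  rewrite map_flatten -map_comp; congr flatten; apply: eq_map => -[[a l] b] /=.
  case: l => [x t|x|c] //=.
  + by rewrite /tree_edge_facts /= tree_singleE.
  + by rewrite /tree_edge_facts /= -!(code_of_ground k) !tree_singleE.
- rewrite (_ : prog_vars p = code_nat k) // tree_rangeE map_flatten -!map_comp.
  congr flatten; apply: eq_map => x /=.
  by rewrite -!(code_of_ground k) !tree_singleE.
- rewrite /prog_procs tree_rangeE -!map_comp; apply: eq_map => q /=.
  by rewrite prog_startE (tree_identityE Om).
- by rewrite /= (tree_identityE Om).
Qed.

Definition init_state : state Om k := [ffun=> g1].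

Lemma tree_initE : tree_init c1 p = code_subst (ground_subst init_state).
Proof.
rewrite /tree_init (_ : prog_vars p = code_nat k) // tree_rangeE -map_comp.
by apply: eq_map => x; rewrite /ground_subst ffunE code_of_ground.
Qed.

Lemma In_filter (T : Type) (a : pred T) (s : seq T) x :
  List.In x [seq y <- s | a y] <-> List.In x s /\ a x.
Proof.
elim: s => [|y s IH] /=; first by split=> // -[].
case: ifP => ay /=; rewrite IH; split.
- by case=> [<-|[]]; auto.
- by case=> -[<-|]; auto.
- by case; auto.
- by case=> -[yx|]; rewrite -?yx ?ay; auto.
Qed.

Definition reached_at (h : nat) (u : point P) : seq (state Om k) :=
  [seq apply_subst f.2 init_state | f <- [seq f <-
    iter h (derive (tree_rules p)) (program_facts P g1 g2)
    | f.1 == lab_reach (code_point u)]].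

Lemma In_reached_at h u s : List.In s (reached_at h u) <->
  exists2 r, List.In (lab_reach (code_point u), r)
      (iter h (derive (tree_rules p)) (program_facts P g1 g2)) &
    s = apply_subst r init_state.
Proof.
rewrite /reached_at; split.
  case/In_map => -[l r] /In_filter [hf hl] ->; exists r => //.
  by have /eqP <- := hl.
case=> r hf ->; apply/In_map; exists (lab_reach (code_point u), r) => //.
by apply/In_filter; rewrite eqxx.
Qed.

Definition reached (u : point P) (extra : tree) : seq (state Om k) :=
  reached_at (height_bound (tree_bound c1 c2 p extra)) u.

Lemma tree_statesE u extra :
  tree_states c1 c2 p (code_point u) extra = [seq code_state s | s <- reached u extra].
Proof.
rewrite /tree_states /tree_saturated tree_factsE tree_iterE /reached.
move: (height_bound _) => h; rewrite /reached_at.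
rewrite filter_map -!map_comp; apply: eq_map => f /=.
rewrite code_seqK tree_initE tree_compE /code_state; congr code_seq.
by apply: eq_map => x; rewrite seq_ground_subst.
Qed.

Lemma reached_at_valid (u : point P) (extra : tree) (e : equality Om k) n :
  n = tree_bound c1 c2 p extra ->
  unary_assignments P -> two_variable e ->
  term_size e.1 + term_size e.2 <= tree_size extra ->
  valid_at u e <->
  forall s, List.In s (reached_at (height_bound n) u) -> holds s e.
Proof.
move=> nB uP /andP [uA uB] he.
have vf := valid_facts g12 tree_rulesP init_state u e.
split=> [/vf v s|hs].
  by case/In_reached_at => r hf ->; exact: v hf.
apply/vf; case: e uA uB he hs {vf} => A B /= uA uB he hs.
have fP := @program_facts_unary _ P g1 g2 uP.
pose R := tree_size (code_seq (tree_rules p)).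
pose F := tree_size (code_seq (tree_facts c1 c2 p)).
pose I := tree_size (code_seq (tree_init c1 p)).
have nE : n = (R + (F + (I + tree_size extra).+1).+1).+1 by rewrite nB.
have hR : size (tree_rules p) <= R by exact: size_le_code_seq.
have hF : size (program_facts P g1 g2) <= F.
  by apply: leq_trans (size_le_code_seq _); rewrite tree_factsE size_map.
have hI : \sum_x (term_size (init_state x)).+1 <= I.
  rewrite /I tree_initE; apply: leq_trans (tree_size_code_subst _).
  by apply: leq_sum => x _; rewrite /ground_subst term_size_of_ground.
have hS : \sum_(f <- program_facts P g1 g2) fact_size f <= F.
  rewrite /F tree_factsE tree_size_code_seq big_map; apply: leq_sum => f _.
  rewrite /= -addnS -addSn ltnW // ltnS (leq_trans _ (leq_addl _ _)) //.
  apply: leq_trans (leq_trans (tree_size_code_subst _) (leqnSn _)).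
  by apply: leq_sum => x _; exact: leqnSn.
have hk : k <= I.
  apply: leq_trans hI; rewrite -[X in X <= _]card_ord -sum1_card.
  exact: leq_sum.
have hI' : \sum_x term_size (init_state x) <= I.
  by apply: leq_trans hI; apply: leq_sum => x _; exact: leqnSn.
have total : \sum_(f <- program_facts P g1 g2) fact_size f +
    \sum_x term_size (init_state x) + (term_size A + term_size B) <= n.
  by rewrite nE; lia.
apply: (saturation (n := n) fP uA uB) => //; try (by rewrite nE; lia).
by move=> r hr; apply: hs; apply/In_reached_at; exists r.
Qed.

Theorem reached_valid (u : point P) (extra : tree) (e : equality Om k) :
  unary_assignments P -> two_variable e ->
  term_size e.1 + term_size e.2 <= tree_size extra ->
  valid_at u e <-> forall s, List.In s (reached u extra) -> holds s e.
Proof. exact: reached_at_valid. Qed.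

End Compile.
End Correctness.

(** * The inferred equalities *)

Section Patterns.
Variables (Om : signature) (k : nat) (s : state Om k) (y : 'I_k).
Local Notation tm := (term Om 'I_k).

Lemma term_size_subst (t : tm) : term_size t <= term_size (subst s t).
Proof.
elim/term_nested_ind: t => [x|f a IH] /=; first exact: term_size_gt0.
by rewrite ltnS leq_sum // => i _; rewrite ffunE.
Qed.

(** A term over [y] with value [g] is [y] itself, if [g] is the value of [y], or has the root of [g]
    and such terms as arguments; the recursion lists both options. *)
Lemma tree_patternsP (g : ground Om) c :
  c \in tree_patterns (Node Leaf (code_nat y)) (code_ground (s y)) (code_ground g) <->
  exists t : tm, [/\ c = code_term t, vars t \subset [set y] & subst s t = g].
Proof.
set w := Node Leaf (code_nat y); set v := code_ground (s y).
pose R := trec (Node Leaf (Node (code_seq [:: Leaf]) Leaf)) (fun a b ra rb =>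
    Node (code_seq ((if Node a b == v then [:: w] else [::]) ++
            [seq Node a (Node (lchild b) q) | q <- tlist (rchild (rchild rb))]))
   (Node (code_seq (flatten [seq [seq Node p q | q <- tlist (lchild (rchild rb))]
                            | p <- tlist (lchild ra)]))
         (lchild (rchild rb)))).
pose T t := tlist (lchild (R t)); pose L t := tlist (lchild (rchild (R t))).
have TE a b : T (Node a b) = (if Node a b == v then [:: w] else [::]) ++
    [seq Node a (Node (lchild b) q) | q <- tlist (rchild (rchild (R b)))].
  by rewrite /T /= code_seqK.
have LE a b : L (Node a b) = flatten [seq [seq Node p q | q <- L b] | p <- T a].
  by rewrite /L /= code_seqK.
have R3 a b : rchild (rchild (R (Node a b))) = lchild (rchild (R b)) by [].
(* On the code of a list, the second component lists all choices of one pattern per element. *)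
have LP cs q : q \in L (code_seq cs) <->
    exists qs, [/\ q = code_seq qs, size qs = size cs &
      forall i, i < size cs -> nth Leaf qs i \in T (nth Leaf cs i)].
  elim: cs q => [|c0 cs IH] q.
    rewrite /L /= inE; split=> [/eqP ->|]; first by exists [::].
    by case=> -[|? ?] [->].
  change (code_seq (c0 :: cs)) with (Node c0 (code_seq cs)); rewrite LE; split.
    case/flatten_mapP => p pT /mapP [q' /IH [qs [-> sz h]] ->].
    exists (p :: qs); split=> //=; first by rewrite sz.
    by case=> // i; exact: h.
  case=> -[|p qs] [-> //= [sz] h]; apply/flatten_mapP; exists p; first exact: (h 0).
  apply: map_f; apply/IH; exists qs; split=> // i; exact: (h i.+1).
have gI (a b : ground Om) : code_ground a = code_ground b -> a = b.
  by apply: code_with_inj => -[].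
change (c \in T (code_ground g) <-> exists t : tm,
  [/\ c = code_term t, vars t \subset [set y] & subst s t = g]).
elim/term_nested_ind: g c => [[]|f a IH] c.
have -> : T (code_ground (App f a)) =
    (if code_ground (App f a) == v then [:: w] else [::]) ++
    [seq Node (Node Leaf Leaf) (Node (code_nat (pickle f)) q)
    | q <- L (code_seq [seq code_ground (a i) | i <- enum 'I_(arity f)])].
  by rewrite [LHS]TE R3.
set cs := [seq code_ground _ | _ <- _].
have szc : size cs = arity f by rewrite size_map size_enum_ord.
have nthc (i : 'I_(arity f)) : nth Leaf cs i = code_ground (a i).
  by rewrite (nth_map i) ?nth_ord_enum // size_enum_ord.
rewrite mem_cat; split.
  case/orP.
    case: eqP => // /gI E; rewrite inE => /eqP ->.
    by exists (Var y); split=> //=; exact/esym.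
  case/mapP => q /LP [qs [-> sz h]] ->.
  have : forall i : 'I_(arity f), exists t : tm, [/\ nth Leaf qs i = code_term t,
      vars t \subset [set y] & subst s t = a i].
    by move=> i; apply/IH; rewrite -nthc; apply: h; rewrite szc.
  case/fin_all_exists => t ht; exists (App f (finfun t)); split.
  - congr (Node _ (Node _ (code_seq _))); apply: (@eq_from_nth _ Leaf).
      by rewrite sz szc size_map size_enum_ord.
    move=> i; rewrite sz szc => hi; rewrite (nth_map (Ordinal hi)) ?size_enum_ord //.
    have -> : nth (Ordinal hi) (enum 'I_(arity f)) i = Ordinal hi.
      exact: (nth_ord_enum (Ordinal hi) (Ordinal hi)).
    by rewrite ffunE; have [] := ht (Ordinal hi).
  - by apply/bigcupsP => i _; rewrite ffunE; have [] := ht i.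
  - by congr App; apply/ffunP => i; rewrite !ffunE; have [] := ht i.
case=> -[x|f' b] [-> /= hv].
  move=> E; move: hv; rewrite sub1set inE => /eqP xy; rewrite xy in E *.
  by apply/orP; left; rewrite -E eqxx inE.
move=> E; have [/esym E1 _] := E; case: f' / E1 b hv E => b hv.
move=> /App_inj/ffunP E; apply/orP; right; apply: map_f; apply/LP.
exists [seq code_term (b i) | i <- enum 'I_(arity f)]; split=> //.
  by rewrite szc size_map size_enum_ord.
rewrite szc => i hi; rewrite (nthc (Ordinal hi)).
rewrite (nth_map (Ordinal hi)) ?size_enum_ord //.
have -> : nth (Ordinal hi) (enum 'I_(arity f)) i = Ordinal hi.
  exact: (nth_ord_enum (Ordinal hi) (Ordinal hi)).
apply/IH; exists (b (Ordinal hi)); split=> //.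
- by move/bigcupsP: hv; apply.
- by rewrite -E ffunE.
Qed.

End Patterns.

(** * Reduction to equalities with a variable on one side *)

Section SolvedForms.
Variables (Om : signature) (k : nat).
Local Notation tm := (term Om 'I_k).

Lemma tree_candidatesP (s : state Om k) c :
  c \in tree_candidates (code_nat k) (code_state s) <->
  exists x y (t : tm), [/\ c = code_equality (Var x, t),
     vars t \subset [set y] & subst s t = s x].
Proof.
have nthE (x : 'I_k) : tree_nth (code_state s) (code_nat x) = code_ground (s x).
  by rewrite /code_state tree_nthE nth_code_subst code_of_ground.
rewrite /tree_candidates tree_rangeE; split.
  case/flatten_mapP => _ /mapP [x _ ->] /flatten_mapP [_ /mapP [y _ ->]].
  rewrite !nthE => /mapP [_ /tree_patternsP [t [-> ht E]] ->].
  by exists x, y, t.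
case=> x [y [t [-> ht E]]].
apply/flatten_mapP; exists (code_nat x); first by apply/mapP; exists x; rewrite ?mem_enum.
apply/flatten_mapP; exists (code_nat y); first by apply/mapP; exists y; rewrite ?mem_enum.
rewrite !nthE; apply/mapP; exists (code_term t) => //.
by apply/tree_patternsP; exists t.
Qed.

Lemma unary_support (t : tm) (x : 'I_k) : #|vars t| <= 1 ->
  exists y, vars t \subset [set y].
Proof.
move=> h; case: (set_0Vmem (vars t)) => [->|[y hy]]; first by exists x; rewrite sub0set.
exists y; apply/subsetP => z hz; rewrite inE; apply/eqP.
exact: (card_le1_eqP h).
Qed.

(** Equal roots are stripped and the arguments compared, until one side is a variable. *)
Lemma solved_forms (S : state Om k -> Prop) (s0 s : state Om k) :
  S s0 ->
  (forall x y (t : tm), vars t \subset [set y] ->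
     (forall r, S r -> holds r (Var x, t)) -> holds s (Var x, t)) ->
  forall e, two_variable e -> (forall r, S r -> holds r e) -> holds s e.
Proof.
move=> S0 hE [A B] /andP [/=].
elim/term_nested_ind: A B => [x|f a IH] B uA uB hS.
  by have [y hy] := unary_support x uB; exact: hE hy hS.
case: B uB hS => [x|g b] uB hS.
  have [y hy] := unary_support x uA.
  by apply/esym; apply: (hE x y) => // r /hS.
(* The equality holds in [s0], so the two roots agree. *)
have [E _] := hS s0 S0; case: g / E b uB hS => b uB hS.
congr App; apply/ffunP => i; rewrite !ffunE.
have le1 (c : {ffun 'I_(arity f) -> tm}) : #|vars (App f c)| <= 1 -> #|vars (c i)| <= 1.
  by apply: leq_trans; apply: subset_leq_card; exact: bigcup_sup.
apply: IH; [exact: le1 uA|exact: le1 uB|].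
by move=> r /hS /App_inj/ffunP/(_ i); rewrite !ffunE.
Qed.

Lemma decode_all (Q : equality Om k -> Prop) (l : seq tree) :
  (forall c, c \in l -> exists2 e, c = code_equality e & Q e) ->
  exists2 E, l = [seq code_equality e | e <- E] & forall e, List.In e E -> Q e.
Proof.
elim: l => [|c l IH] h; first by exists [::].
have [e ce qe] := h c (mem_head _ _).
have [E lE hE] : exists2 E, l = [seq code_equality e | e <- E] &
    forall e, List.In e E -> Q e.
  by apply: IH => d dl; apply: h; rewrite in_cons dl orbT.
exists (e :: E); first by rewrite /= -ce -lE.
by move=> d [<-|/hE].
Qed.

End SolvedForms.

Section Correct.
Variables (Om : signature) (g1 g2 : ground Om).
Hypothesis g12 : g1 <> g2.
Local Notation c1 := (code_ground g1).
Local Notation c2 := (code_ground g2).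

Lemma all_tree_holds k (S : seq (state Om k)) (e : equality Om k) :
  all (fun r => tree_holds r (code_equality e)) [seq code_state s | s <- S] <->
  forall s, List.In s S -> holds s e.
Proof.
elim: S => [|s S IH] //=; split.
  by case/andP => /(tree_holdsP g1) hs /IH hS r [<-|/hS].
move=> h; apply/andP; split; first by apply/(tree_holdsP g1)/h; left.
by apply/IH => r hr; apply: h; right.
Qed.

Lemma tree_decideP (P : program Om) (u : point P) (e : equality Om (nvars P)) :
  unary_assignments P -> two_variable e ->
  tree_decide c1 c2 (code_program P) (code_point u) (code_equality e) <-> valid_at u e.
Proof.
move=> uP ue; have sz : term_size e.1 + term_size e.2 <= tree_size (code_equality e).
  by rewrite /= ltnW // ltnS leq_add // tree_size_code_term.
rewrite (reached_valid g12 u uP ue sz) /tree_decide tree_statesE.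
exact: all_tree_holds.
Qed.

Lemma reached_reaches (P : program Om) (u : point P) extra s :
  List.In s (reached g1 g2 u extra) -> exists st, reaches (u, st, s).
Proof.
rewrite /reached; move: (height_bound _) => h /In_reached_at [r hf ->].
have [_ _ C _] := facts_sound (@tree_rulesP _ P) hf.
exact: C.
Qed.

(** The candidates are the solved forms that hold in one reachable state [s0]. Those that survive
    the test are valid, and by [solved_forms] they entail every valid equality. *)
Lemma tree_inferP (P : program Om) (u : point P) : unary_assignments P ->
  exists E : seq (equality Om (nvars P)),
    [/\ tree_infer c1 c2 (code_program P) (code_point u) =
          [seq code_equality e | e <- E],
        all (@two_variable Om (nvars P)) E &
        forall e, two_variable e -> (valid_at u e <-> entails E e)].
Proof.
move=> uP; set k := nvars P; pose G (g : ground Om) := of_ground 'I_k g.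
have codeG : code_equality (G g1, G g2) = Node c1 c2.
  by rewrite /code_equality !code_of_ground.
have uG : two_variable (G g1, G g2) by rewrite /two_variable !vars_of_ground cards0.
have szG : term_size (G g1, G g2).1 + term_size (G g1, G g2).2 <= tree_size (Node c1 c2).
  by rewrite -codeG /= ltnW // ltnS leq_add // tree_size_code_term.
have vG := reached_valid g12 u uP uG szG.
have reachG := @reached_reaches P u (Node c1 c2).
rewrite /tree_infer tree_statesE.
move: (reached g1 g2 u (Node c1 c2)) vG reachG => [|s0 S0] vG reachG.
  (* Without a witness, the false equality of [g1] and [g2] is valid at [u]: the point is
     unreachable, and this equality entails all others. *)
  exists [:: (G g1, G g2)]; split; [by rewrite /= codeG|by rewrite /= uG|].
  have noG s : ~ holds s (G g1, G g2).
    by rewrite /holds /= !subst_of_ground_ground.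
  move=> e _; split=> [_ s hs|_ st s hu]; first by case: (noG s); apply: hs; left.
  by case: (noG s); apply: (vG.2 _ _ _ hu).
have [st0 reach0] := reachG s0 (or_introl erefl).
have -> : tree_infer_from c1 c2 (code_program P) (code_point u)
    [seq code_state s | s <- s0 :: S0] =
  [seq e <- tree_candidates (code_nat k) (code_state s0)
  | all (fun r => tree_holds r e) (tree_states c1 c2 (code_program P) (code_point u)
      (code_state s0))] by [].
rewrite tree_statesE.
have valid e := @reached_valid Om g1 g2 g12 P u (code_state s0) e uP.
have reach := @reached_reaches P u (code_state s0).
move: (reached g1 g2 u (code_state s0)) valid reach => S valid reach.
pose Q (e : equality Om k) := [/\ two_variable e, valid_at u e &
  code_equality e \in [seq e <- tree_candidates (code_nat k) (code_state s0)
    | all (fun r => tree_holds r e) [seq code_state s | s <- S]]].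
have [E lE hE] : exists2 E : seq (equality Om k),
    [seq e <- tree_candidates (code_nat k) (code_state s0)
    | all (fun r => tree_holds r e) [seq code_state s | s <- S]] =
    [seq code_equality e | e <- E] & forall e, List.In e E -> Q e.
  apply: decode_all => c hc; have := hc; rewrite mem_filter.
  case/andP => hS /tree_candidatesP [x [y [t [cE ht E]]]].
  have ut : two_variable (Var x, t).
    by rewrite /two_variable /= cards1 /= -(cards1 y) subset_leq_card.
  exists (Var x, t) => //; split=> //; last by rewrite -cE.
  apply/valid => //; last by apply/all_tree_holds; rewrite -cE.
  (* A candidate is no larger than the value of [x] in [s0], so the code of [s0] is a sufficient
     [extra]. *)
  have st : term_size t <= term_size (s0 x) by rewrite -E term_size_subst.
  apply: leq_trans (tree_size_code_subst _); rewrite (bigD1 x) //=.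
  by rewrite add1n /ground_subst term_size_of_ground addSn ltnS (leq_trans st) // leq_addr.
exists E; split.
- exact: lE.
- by apply/allP => e /In_mem/hE [].
move=> e ue; split=> [ve s hs|ent st s hu]; last first.
  by apply: ent => e' /hE [_ v _]; exact: v hu.
(* [s0] was found under another bound and is not known to belong to [S]. *)
pose R r := r = s0 \/ List.In r S.
apply: (@solved_forms _ _ R s0 s (or_introl erefl) _ e ue); last first.
  by move=> r [->|/reach [st hr]]; [exact: ve reach0|exact: ve hr].
move=> x y t ht hR.
have : code_equality (Var x, t) \in [seq code_equality e | e <- E].
  rewrite -lE mem_filter; apply/andP; split.
    by apply/all_tree_holds => r hr; apply: hR; right.
  by apply/tree_candidatesP; exists x, y, t; split=> //; apply/esym; apply: hR; left.
case/In_mem/In_map => e' he' [h1 h2].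
have -> : (Var x, t) = e'.
  by case: (e') h1 h2 => a b /= h1 h2; congr pair; apply: code_term_inj.
exact: hs.
Qed.

End Correct.

Theorem theorem8 (Om : signature) (c : Om) (hc : arity c = 0) :
  (exists A : algorithm, infers Om A) /\ (exists A : algorithm, decides Om A).
Proof.
case: (classic (exists g1 g2 : ground Om, g1 <> g2)) => [[g1 [g2 g12]]|h]; last first.
  (* With at most one ground term every equality is valid, and constant algorithms suffice. *)
  have eqg (a b : ground Om) : a = b.
    by apply: NNPP => ne; apply: h; exists a, b.
  split.
    have [A hA] := computable_runs (computable_const (code_seq [::])).
    exists A => P u _; exists [::]; split; [exact: hA|by []|] => e _.
    by split=> [_ s _|_ st s _]; exact: eqg.
  have [A hA] := computable_runs (computable_const (code_bool true)).
  exists A => P u _ e _; exists true; split; first exact: hA.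
  by split=> // _ st s _; exact: eqg.
split.
  have [A hA] := computable_runs (computable_tree_infer (code_ground g1) (code_ground g2)).
  exists A => P u uP; have [E [EE uE hE]] := tree_inferP g12 u uP.
  exists E; split=> //; rewrite -EE; exact: (hA (Node _ _)).
have [A hA] := computable_runs (computable_tree_decide (code_ground g1) (code_ground g2)).
exists A => P u uP e ue; eexists; split; last exact: (tree_decideP g12 u uP ue).
exact: (hA (Node _ (Node _ _))).
Qed.
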